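(* Let $\Omega\subset\mathbb{C}^n$ be a P-hyperconvex domain and let $u$ be a function on $\overline{\Omega}$ that is plurisubharmonic on $\Omega$ and upper semicontinuous on $\overline{\Omega}$. If there is a function $v \in \mathcal{PSH}(\overline{\Omega})$ such that $u|_{\partial \Omega}=v|_{\partial \Omega}$, then $u\in \mathcal{PSH}(\overline{\Omega})$.
   Context: A domain is a connected open set. Upper semicontinuous functions take values in $[-\infty,\infty)$. For a compact set $X\subset\mathbb{C}^n$: - $\mathcal{PSH}^o(X)$ is the set of functions $u$ on $X$ for which there exist an open set $U\supset X$ and a function $\tilde u$, plurisubharmonic and continuous on $U$, with $\tilde u|_X=u$. - For $z\in X$, the set $\mathcal{J}_z(X)$ of Jensen measures for $z$ is the set of all (regular Borel) probability measures $\mu$ on $X$ such that $u(z)\le\int u\,d\mu$ for all $u\in\mathcal{PSH}^o(X)$. - $\mathcal{PSH}(X)$, the set of plurisubharmonic functions on the compact set $X$, is the set of all upper semicontinuous functions $u$ on $X$ such that $u(z)\le\int u\,d\mu$ for every $z\in X$ and every $\mu\in\mathcal{J}_z(X)$. A bounded domain $\Omega\subset\mathbb{C}^n$ is called P-hyperconvex if there is a non-constant function $\phi\in\mathcal{PSH}(\overline{\Omega})\cap C(\overline{\Omega})$ such that $\phi(z)=0$ for all $z\in\partial\Omega$. *)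

(* Defs.v *)
From HB Require Import structures.
From mathcomp Require Import all_boot all_order all_algebra.
From mathcomp Require Import complex.
From mathcomp Require Import all_classical all_reals all_analysis.

Set Implicit Arguments.
Unset Strict Implicit.
Unset Printing Implicit Defensive.

Import Order.TTheory GRing.Theory Num.Theory.
Import numFieldNormedType.Exports.

Local Open Scope classical_set_scope.
Local Open Scope ring_scope.

(* numFieldNormedType only covers structures that are variables; the concrete
   field R[i] needs its own instances.  'rV[R[i]]_n then carries the product
   topology and the sup norm (with values in R[i]). *)
#[warnings="-redundant-canonical-projection"]
HB.instance Definition _ (R : realType) := PseudoPointedMetric.copy R[i] R[i]^o.
#[warnings="-redundant-canonical-projection"]
HB.instance Definition _ (R : realType) := NormedModule.copy R[i] R[i]^o.

Notation borel T := (g_sigma_algebraType (@open T)).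

Definition boundary (T : topologicalType) (A : set T) : set T :=
  closure A `\` A°.

(* Functions on a subset A are represented by total functions whose values
   outside A are irrelevant.  Here f is upper semicontinuous on A for the
   relative topology, with values in [-oo, +oo[ on A. *)
Definition usc_on (R : realType) (T : topologicalType) (A : set T)
    (f : T -> \bar R) : Prop :=
  forall x, A x -> (f x < +oo)%E /\
    forall a : R, (f x < a%:E)%E ->
      \forall y \near within A (nbhs x), (f y < a%:E)%E.

Definition circle_mean (R : realType) (f : R[i] -> \bar R) (a : R[i]) (r : R)
    : \bar R :=
  (((2 * pi)^-1)%:E *
   \int[lebesgue_measure]_(t in `[0%R, (2 * pi)%R])
     f (a + (r%:C)%C * (cos t +i* sin t)%C)%R)%E.

(* The function identically -oo is allowed. *)
Definition subharmonic (R : realType) (V : set R[i]) (f : R[i] -> \bar R) : Prop :=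
  usc_on V f /\
  forall (a : R[i]) (r : R), 0 < r ->
    (forall w : R[i], `|w - a| <= (r%:C)%C -> V w) ->
    (f a <= circle_mean f a r)%E.

Definition psh (R : realType) (n : nat) (U : set 'rV[R[i]]_n)
    (u : 'rV[R[i]]_n -> \bar R) : Prop :=
  usc_on U u /\
  forall a b : 'rV[R[i]]_n,
    subharmonic [set w : R[i] | U (a + w *: b)] (fun w => u (a + w *: b)).

(* Continuous functions are real-valued. *)
Definition PSHo (R : realType) (n : nat) (X : set 'rV[R[i]]_n)
    (u : 'rV[R[i]]_n -> R) : Prop :=
  exists (U : set 'rV[R[i]]_n) (u' : 'rV[R[i]]_n -> R),
    [/\ open U, X `<=` U, psh U (EFin \o u'), {within U, continuous u'}
      & forall x, X x -> u' x = u x].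

Definition regular_measure (R : realType) (T : ptopologicalType)
    (mu : set (borel T) -> \bar R) : Prop :=
  forall A : set (borel T), measurable A ->
    mu A = ereal_inf [set mu U | U in [set U : set T | open U /\ A `<=` U]] /\
    mu A = ereal_sup [set mu K | K in [set K : set T | compact K /\ K `<=` A]].

(* Measures on the compact set X are represented by Borel measures on C^n
   concentrated on X. *)
Definition Jensen (R : realType) (n : nat) (X : set 'rV[R[i]]_n)
    (z : 'rV[R[i]]_n) (mu : probability (borel 'rV[R[i]]_n) R) : Prop :=
  [/\ regular_measure mu, mu X = 1%E
    & forall u : 'rV[R[i]]_n -> R, PSHo X u ->
        ((u z)%:E <= \int[mu]_(x in X) (u x)%:E)%E].

Definition PSH (R : realType) (n : nat) (X : set 'rV[R[i]]_n)
    (u : 'rV[R[i]]_n -> \bar R) : Prop :=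
  usc_on X u /\
  forall (z : 'rV[R[i]]_n) (mu : probability (borel 'rV[R[i]]_n) R),
    X z -> Jensen X z mu -> (u z <= \int[mu]_(x in X) u x)%E.

Definition P_hyperconvex (R : realType) (n : nat) (Omega : set 'rV[R[i]]_n)
    : Prop :=
  [/\ open Omega, connected Omega, bounded_set Omega
    & exists phi : 'rV[R[i]]_n -> R,
      [/\ PSH (closure Omega) (EFin \o phi),
          {within closure Omega, continuous phi},
          ~ (exists c : R, forall z, closure Omega z -> phi z = c)
        & forall z, boundary Omega z -> phi z = 0]].

(* Main.v *)
Require Import Defs.
From HB Require Import structures.
From mathcomp Require Import all_boot all_order all_algebra.
From mathcomp Require Import complex.
From mathcomp Require Import all_classical all_reals all_analysis.
From mathcomp Require Import measurable_realfun.
From mathcomp Require Import ring lra.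

Set Implicit Arguments.
Unset Strict Implicit.
Unset Printing Implicit Defensive.

Import Order.TTheory GRing.Theory Num.Theory.
Import numFieldNormedType.Exports.
Local Open Scope classical_set_scope.
Local Open Scope ring_scope.

(** Write [X] for the compact set [closure Omega].  Functions of [PSH X] are
    defined by an inequality against Jensen measures, and the only way to use
    that inequality is to have Jensen measures at hand.  They are provided by
    Edwards' theorem ([exists_Jensen], [edwards_at]): for [h] continuous on [X],
    the supremum at [z] of the functions of [PSHo X] below [h] is the integral
    of [h] against some Jensen measure for [z].  It comes from the Hahn-Banach
    theorem and the Riesz representation theorem.  With
    compactness it gives [PSH_approx]: if [w] is in [PSH X] and [w <= h], then
    some [g] in [PSHo X] satisfies [w - e < g <= h] on [X].

    The negative function.  By [PSH_approx] the function [phi] of the definition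
    of P-hyperconvexity is a uniform limit of functions plurisubharmonic near
    [X], hence it satisfies the sub-mean inequality in [Omega]; being
    nonconstant with boundary values 0, it is negative in [Omega] by the maximum
    principle ([PSH_boundary0_lt0]).

    Gluing.  Let [h >= v] be continuous and [A >= 0].  Choose in [PSHo X] a
    function [g] between [v - e] and [h] and a function [psi] below [phi] with
    [A * (phi - psi) <= e].  Then [G = g + A * psi] is plurisubharmonic near
    [X], and on the boundary it is larger than [u - 2 e], because [u = v] and
    [phi = 0] there.  If [f] is a continuous plurisubharmonic approximation of
    [u] from above, then [f - 3 e < G] near the boundary, so the maximum of
    [f - 3 e] and [G] in [Omega], extended by [G], belongs to [PSHo X].  The
    definition of a Jensen measure [mu] for [z] applies to it, and letting [e]
    tend to 0 yields that [u z] is at most the integral of the maximum of [f0]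
    and [h + A * phi], for all continuous [f0 >= u] ([psh_le_integral_max]).

    Limit.  Let [f0] decrease to [u], [h] decrease to [v] and [A] tend to
    infinity.  As [phi < 0] in [Omega], the maximum decreases to [u] in [Omega],
    and on the boundary it decreases to [u = v].  Monotone convergence gives
    that [u z] is at most the integral of [u].

    Two points replace standard machinery.  The approximation of [u] by
    continuous plurisubharmonic functions uses sup-convolutions ([supconv]),
    which are suprema of translates of [u] minus constants, instead of
    mollifiers.  The glued function satisfies the sub-mean inequality on small
    discs only; [submean_local] extends it to all discs by the maximum principle
    applied to the average of the function over a finite group of rotations of
    the disc. *)

(** * Real-valued norms on complex normed spaces *)

Section RealNorm.
Context {R : realType} {V : normedModType R[i]}.
Implicit Types (x y : V) (A : set V).

(** The norm of a normed module over [R[i]] takes its values in [R[i]]; [nr] is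
    the same norm as an element of [R], where order and suprema live. *)
Definition nr x : R := complex.Re `|x|.

Lemma nrE x : `|x| = (nr x)%:C%C.
Proof.
have := normr_ge0 x; rewrite /nr; case: (`|x|) => a b.
by rewrite lecE /= => /andP[/eqP-> _].
Qed.

Lemma nr_ge0 x : 0 <= nr x.
Proof. by have := normr_ge0 x; rewrite nrE lecE /= => /andP[]. Qed.

Lemma nrD x y : nr (x + y) <= nr x + nr y.
Proof. by have := ler_normD x y; rewrite !nrE -rmorphD /= lecR. Qed.

Lemma nrN x : nr (- x) = nr x.
Proof. by rewrite /nr normrN. Qed.

Lemma nrC x y : nr (x - y) = nr (y - x).
Proof. by rewrite -nrN opprB. Qed.

Lemma nr0 : nr 0 = 0.
Proof. by rewrite /nr normr0. Qed.

Lemma nr_dist x y z : nr (x - z) <= nr (x - y) + nr (y - z).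
Proof. by apply: le_trans (nrD _ _); rewrite addrA subrK. Qed.

Lemma nbhs_nr x A :
  nbhs x A <-> exists2 e : R, 0 < e & forall y, nr (y - x) < e -> A y.
Proof.
split=> [/nbhs_normP[[e e']]|[e e0 H]].
  rewrite /= ltcE /= => /andP[/eqP -> e0] H; exists e => // y yx.
  by apply: H => /=; rewrite distrC nrE ltcR.
apply/nbhs_normP; exists e%:C%C => /=; first by rewrite ltcR.
by move=> y /=; rewrite distrC nrE ltcR; exact: H.
Qed.

Lemma near_nr x (e : R) : 0 < e -> \forall y \near x, nr (y - x) < e.
Proof. by move=> e0; apply/nbhs_nr; exists e. Qed.

Lemma cont_nrP (f : V -> R) x : {for x, continuous f} <->
  forall e, 0 < e -> exists2 d : R, 0 < d & forall y, nr (y - x) < d -> `|f y - f x| < e.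
Proof.
split=> [cf e e0|H].
  have /nbhs_nr[d d0 Hd] : \forall y \near x, `|f y - f x| < e.
    by have /cvgrPdist_lt/(_ e e0) := cf; apply: filterS => y; rewrite distrC.
  by exists d.
apply/cvgrPdist_lt => e /H[d d0 Hd]; apply/nbhs_nr; exists d => // y /Hd.
by rewrite distrC.
Qed.

Lemma lip_continuous (k : R) (f : V -> R) : 0 < k ->
  (forall x y, f x <= f y + k * nr (x - y)) -> continuous f.
Proof.
move=> k0 H x; apply/cont_nrP => e e0; exists (e / k); first by rewrite divr_gt0.
move=> y yx; have {}yx : k * nr (y - x) < e by rewrite mulrC -ltr_pdivlMr.
have := H x y; have := H y x; rewrite (nrC x y) ltr_norml => h1 h2.
by apply/andP; split; lra.
Qed.

End RealNorm.

Lemma nrZ {R : realType} {V : normedModType R[i]} (c : R[i]) (x : V) :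
  nr (c *: x) = nr c * nr x.
Proof.
by have := normrZ c x; rewrite !nrE -rmorphM => /(congr1 (@complex.Re R)).
Qed.

(** * Continuous functions on a subset *)

Section WithinContinuous.
Context {R : realType} {T : topologicalType} (X : set T).
Implicit Types f g : T -> R.

Lemma within_contP f : {within X, continuous f} <->
  forall x, X x -> forall e : R, 0 < e -> \forall y \near x, X y -> `|f y - f x| < e.
Proof.
split=> [/subspace_continuousP cf x Xx e e0|H].
  have /cvgrPdist_lt/(_ e e0) := cf x Xx.
  by rewrite near_withinE; apply: filterS => y h /h; rewrite distrC.
apply/subspace_continuousP => x Xx; apply/cvgrPdist_lt => e e0.
by rewrite near_withinE; apply: filterS (H x Xx e e0) => y h /h; rewrite distrC.
Qed.

Lemma within_cont_gt f x (a : R) : {within X, continuous f} -> X x -> a < f x ->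
  \forall y \near x, X y -> a < f y.
Proof.
move=> /within_contP cf Xx ax; have := cf x Xx (f x - a).
rewrite subr_gt0 => /(_ ax); apply: filterS => y h /h.
by rewrite ltr_norml => /andP[]; lra.
Qed.

Lemma within_cont_lt f x (a : R) : {within X, continuous f} -> X x -> f x < a ->
  \forall y \near x, X y -> f y < a.
Proof.
move=> /within_contP cf Xx ax; have := cf x Xx (a - f x).
rewrite subr_gt0 => /(_ ax); apply: filterS => y h /h.
by rewrite ltr_norml => /andP[]; lra.
Qed.

Lemma within_cont_cst (c : R) : {within X, continuous (fun=> c)}.
Proof. by apply: continuous_subspaceT => x; exact: cvg_cst. Qed.

Lemma within_contD f g : {within X, continuous f} -> {within X, continuous g} ->
  {within X, continuous (fun x => f x + g x)}.
Proof. by move=> cf cg x; apply: cvgD; [exact: cf|exact: cg]. Qed.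

Lemma within_contZ c f : {within X, continuous f} ->
  {within X, continuous (fun x => c * f x)}.
Proof. by move=> cf x; apply: cvgM; [exact: cvg_cst|exact: cf]. Qed.

Lemma within_cont_max f g : {within X, continuous f} -> {within X, continuous g} ->
  {within X, continuous (fun x => Num.max (f x) (g x))}.
Proof. by move=> cf cg x; apply: continuous_max; [exact: cf|exact: cg]. Qed.

Lemma within_cont_min f g : {within X, continuous f} -> {within X, continuous g} ->
  {within X, continuous (fun x => Num.min (f x) (g x))}.
Proof. by move=> cf cg x; apply: continuous_min; [exact: cf|exact: cg]. Qed.

Lemma within_cont_sum (n : nat) (F : nat -> T -> R) :
  (forall k, {within X, continuous (F k)}) ->
  {within X, continuous (fun x => \sum_(k < n) F k x)}.
Proof.
move=> cF; elim: n => [|n IH].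
  by under eq_fun do rewrite big_ord0; exact: within_cont_cst.
by under eq_fun do rewrite big_ord_recr; exact: within_contD.
Qed.

Lemma within_cont_closed_ge f (e : R) : closed X -> {within X, continuous f} ->
  closed [set x | X x /\ e <= f x].
Proof.
move=> clX cf; rewrite -[A in closed A]setCK; apply: open_closedC.
rewrite openE => x /= nx; have [Xx|nX] := pselect (X x).
  have fe : f x < e by rewrite ltNge; apply/negP => h; exact: nx.
  apply: filterS (within_cont_lt cf Xx fe) => y h [Xy].
  by rewrite leNgt h.
have : nbhs x (~` X) by apply: open_nbhs_nbhs; split => //; exact: closed_openC.
by apply: filterS => y nX' [].
Qed.

(** Most uses of compactness below have this form: a sequence of properties,
    each of which holds near every point from some index on, holds uniformly
    from some index on.  Dini's theorem is an instance. *)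
Lemma compact_eventually (P : nat -> T -> Prop) : compact X ->
  (forall x, X x -> exists N, \forall y \near x, forall n, (N <= n)%N -> P n y) ->
  exists N, forall n, (N <= n)%N -> forall x, X x -> P n x.
Proof.
move=> /compact_near_coveringP/(_ _ \oo P) cX H.
have [|N _ HN] := cX _; last by exists N => n; exact: HN.
move=> x /H[N HN].
exists ([set y | forall n, (N <= n)%N -> P n y], [set n | (N <= n)%N]).
  by split => //; exists N.
by move=> [y n] /= [h1 h2]; exact: h1.
Qed.

Lemma within_cont_bounded f : compact X -> {within X, continuous f} ->
  exists2 B : R, 0 < B & forall x, X x -> `|f x| <= B.
Proof.
move=> cX cf.
suff /(compact_eventually cX)[N HN] : forall x, X x -> exists N,
    \forall y \near x, forall n, (N <= n)%N -> X y -> `|f y| <= n%:R.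
  by exists N.+1%:R => // y Xy; exact: (HN N.+1 (leqnSn N) y Xy Xy).
move=> x Xx.
have /within_contP/(_ x Xx 1 ltr01) nf := cf.
have [N hN] : exists N : nat, `|f x| + 1 <= N%:R.
  exists (Num.truncn (`|f x| + 1)).+1; exact/ltW/truncnS_gt.
exists N; apply: filterS nf => y h n Nn /h {}h.
have : N%:R <= n%:R :> R by rewrite ler_nat.
by have := ler_normD (f y - f x) (f x); rewrite subrK; lra.
Qed.

End WithinContinuous.

(** * Measurability and integrals *)

Section BorelMeasurability.
Context {R : realType} {T : ptopologicalType}.
Implicit Types (A : set (borel T)).

Lemma open_borel (U : set T) : open U -> measurable (U : set (borel T)).
Proof. by move=> oU; apply: sub_sigma_algebra. Qed.

Lemma closed_borel (A : set T) : closed A -> measurable (A : set (borel T)).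
Proof.
move=> clA; rewrite -[X in measurable X]setCK; apply: measurableC.
by apply: open_borel; exact: closed_openC.
Qed.

Lemma usc_measurable A (f : T -> \bar R) : measurable A -> usc_on A f ->
  measurable_fun A (f : borel T -> \bar R).
Proof.
move=> mA uf _; apply: (measurability _ (ErealGenInftyO.measurableE R)) => //.
move=> /= _ [_ [a ->] <-].
pose U := [set x : T | \forall y \near x, A y -> (f y < a%:E)%E].
have oU : open U by rewrite openE => x /= /nbhs_interior.
suff -> : A `&` f @^-1` `]-oo, a%:E[%classic = A `&` U.
  by apply: measurableI => //; exact: open_borel.
apply/seteqP; split=> x [Ax /=]; rewrite in_itv/=.
  by move=> fa; split => //; have [_ /(_ a fa)] := uf x Ax; rewrite near_withinE.
by move=> Ux; split => //; exact: (nbhs_singleton Ux).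
Qed.

Lemma within_cont_usc (A : set T) (f : T -> R) :
  {within A, continuous f} -> usc_on A (EFin \o f).
Proof.
move=> cf x Ax; split=> [|a]; first exact: ltry.
by rewrite lte_fin near_withinE => /(within_cont_lt cf Ax).
Qed.

Lemma within_cont_measurable A (f : T -> R) : measurable A ->
  {within (A : set T), continuous f} -> measurable_fun A (f : borel T -> R).
Proof.
move=> mA cf; apply/measurable_EFinP; apply: (@usc_measurable A (EFin \o f)) => //.
exact: within_cont_usc.
Qed.

Lemma within_cont_integrable (mu : probability (borel T) R) (A : set T) (f : T -> R) :
  compact A -> closed A -> {within A, continuous f} ->
  mu.-integrable A (EFin \o (f : borel T -> R)).
Proof.
move=> cptA clA cf; apply: measurable_bounded_integrable.
- exact: closed_borel.
- by apply: le_lt_trans (probability_le1 mu _) (ltry 1); exact: closed_borel.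
- by apply: within_cont_measurable => //; exact: closed_borel.
have [B B0 fB] := within_cont_bounded cptA cf.
by exists B; split; [exact: num_real|] => M BM x Ax; exact: (le_trans (fB x Ax) (ltW BM)).
Qed.

End BorelMeasurability.

Section IntegralMonotone.
Local Open Scope ereal_scope.

(** The positive and negative parts are compared separately, so that functions
    with integral [-oo] are covered. *)
Lemma le_integral_measurable d (T : measurableType d) (R : realType)
    (mu : {measure set T -> \bar R}) (D : set T) (f g : T -> \bar R) :
  measurable D -> measurable_fun D f -> measurable_fun D g ->
  (forall x, D x -> f x <= g x) ->
  \int[mu]_(x in D) f x <= \int[mu]_(x in D) g x.
Proof.
move=> mD mf mg fg; rewrite [leLHS]integralE [leRHS]integralE; apply: leeB.
  apply: ge0_le_integral => //; try exact: measurable_funepos.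
  move=> x Dx; rewrite !funeposE.
  by rewrite ge_max le_max fg//= le_max lexx orbT.
apply: ge0_le_integral => //; try exact: measurable_funeneg.
move=> x Dx; rewrite !funenegE.
by rewrite ge_max !le_max leeN2 fg//= lexx orbT.
Qed.

End IntegralMonotone.

(** * The Hahn-Banach theorem *)

Section HahnBanach.
Context {R : realType} {V : lmodType R} (S : set V).
Hypothesis SD : forall f g, S f -> S g -> S (f + g).
Hypothesis SZ : forall c f, S f -> S (c *: f).
Implicit Types (p q : V -> R) (f g : V).

Definition sublinear_on p :=
  (forall f g, S f -> S g -> p (f + g) <= p f + p g) /\
  (forall c f, 0 < c -> S f -> p (c *: f) <= c * p f).

Let SN f : S f -> S (- f).
Proof. by move=> Sf; rewrite -scaleN1r; exact: SZ. Qed.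

Let S0 f : S f -> S 0.
Proof. by move=> Sf; rewrite -(scale0r f); exact: SZ. Qed.

Let sublinearZ p c f : sublinear_on p -> 0 <= c -> S f -> p (c *: f) = c * p f.
Proof.
move=> [pD pZ]; rewrite le_eqVlt => /predU1P[<- Sf|c0 Sf].
  have S00 := S0 Sf; rewrite scale0r mul0r; apply/eqP; rewrite eq_le.
  have := pD _ _ S00 S00; have := @pZ 2^-1 _ _ S00; rewrite scaler0 addr0.
  by rewrite invr_gt0 ltr0n => /(_ isT) h1 h2; apply/andP; split; lra.
apply/eqP; rewrite eq_le pZ//= -ler_pdivlMl//.
rewrite -{1}(scale1r f) -(@mulVf _ c) ?gt_eqF// -scalerA pZ ?invr_gt0//.
exact: SZ.
Qed.

Let sublinear_lb p f g : sublinear_on p -> S f -> S g ->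
  p f - p (- g) <= p (f + g).
Proof.
move=> [pD _] Sf Sg; rewrite lerBlDr.
by have := pD (f + g) (- g) (SD Sf Sg) (SN Sg); rewrite addrK.
Qed.

Let sublinear0 p f : sublinear_on p -> S f -> p 0 = 0.
Proof.
by move=> ps Sf; have := sublinearZ ps (lexx 0) Sf; rewrite scale0r mul0r.
Qed.

(** A sublinear minorant of [q] for which [shear q f g <= q (g + f) - q f]: if
    [q] has no smaller sublinear minorant, then this makes [q] additive. *)
Let shear q f g := inf [set q (g + t *: f) - t * q f | t in [set t : R | 0 <= t]].

Let shear_lb q f g : sublinear_on q -> S f -> S g -> lbound
  [set q (g + t *: f) - t * q f | t in [set t : R | 0 <= t]] (- q (- g)).
Proof.
move=> qs Sf Sg _ [t t0 <-]; rewrite lerBrDr -(sublinearZ qs) // addrC.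
by rewrite (addrC g); apply: sublinear_lb => //; exact: SZ.
Qed.

Let shear_le q f g t : sublinear_on q -> S f -> S g -> 0 <= t ->
  shear q f g <= q (g + t *: f) - t * q f.
Proof.
move=> qs Sf Sg t0; apply: ge_inf; last by exists t.
by exists (- q (- g)); exact: shear_lb.
Qed.

Let shear_sublinear q f : sublinear_on q -> S f -> sublinear_on (shear q f).
Proof.
move=> qs Sf.
have shear_ge (a : R) g : S g ->
    (forall t : R, 0 <= t -> a <= q (g + t *: f) - t * q f) ->
    a <= shear q f g.
  move=> Sg H; apply: lb_le_inf; first by exists (q (g + 0 *: f) - 0 * q f), 0 => /=.
  by move=> _ [t t0 <-]; exact: H.
split=> [g h Sg Sh|c g c0 Sg].
  rewrite -lerBlDr; apply: (shear_ge _ _ Sg) => t t0; rewrite lerBlDr -lerBlDl.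
  apply: (shear_ge _ _ Sh) => s s0; rewrite lerBlDl.
  apply: le_trans (shear_le qs Sf (SD Sg Sh) (addr_ge0 t0 s0)) _.
  rewrite scalerDl addrACA mulrDl.
  by have := qs.1 (g + t *: f) (h + s *: f) (SD Sg (SZ _ Sf)) (SD Sh (SZ _ Sf)); lra.
rewrite -ler_pdivrMl//; apply: shear_ge => // t t0; rewrite ler_pdivrMl//.
apply: le_trans (shear_le qs Sf (SZ _ Sg) (mulr_ge0 (ltW c0) t0)) _.
rewrite -scalerA -scalerDr mulrBr mulrA lerD2r.
by apply: qs.2 => //; exact: SD (SZ _ _).
Qed.

(** A minimal sublinear functional is linear, because it coincides with its
    shears; Zorn's lemma gives a minimal one below the shear of [p] along [f0],
    and it still has the value [p f0] at [f0]. *)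
Lemma hahn_banach p f0 : sublinear_on p -> S f0 ->
  exists L : V -> R,
    [/\ forall f g, S f -> S g -> L (f + g) = L f + L g,
        forall c f, S f -> L (c *: f) = c * L f,
        forall f, S f -> L f <= p f & L f0 = p f0].
Proof.
move=> ps Sf0; set p0 := shear p f0.
have p0s : sublinear_on p0 by exact: shear_sublinear.
have p0p f : S f -> p0 f <= p f.
  move=> Sf; have := shear_le ps Sf0 Sf (lexx 0).
  by rewrite scale0r addr0 mul0r subr0.
pose W := {q : V -> R | sublinear_on q /\ forall f, S f -> q f <= p0 f}.
pose le (q r : W) := `[< forall f, S f -> sval r f <= sval q f >].
have [||A tA|[q [qs qp0]] /= qmax] :=
  @ZL_preorder W (exist _ p0 (conj p0s (fun f _ => lexx _))) le.
- by move=> t; apply/asboolP.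
- move=> r s t /asboolP rs /asboolP st; apply/asboolP => f Sf.
  by rewrite (le_trans (st f Sf)) ?rs.
- have [[a Aa]|A0] := pselect (A !=set0); last first.
    exists (exist _ p0 (conj p0s (fun f _ => lexx _))) => s As.
    by exfalso; apply: A0; exists s.
  pose B f := [set sval r f | r in A]; pose q f := inf (B f).
  have q_le r f : A r -> S f -> q f <= sval r f.
    move=> Ar Sf; apply: ge_inf; last by exists r.
    exists (- p0 (- f)) => _ [s As <-]; rewrite lerNl.
    have [ss sp0] := svalP s; apply: le_trans (sp0 _ (SN Sf)).
    have := sublinear_lb ss (S0 Sf) Sf.
    by rewrite add0r (sublinear0 ss Sf); lra.
  have q_ge c f : (forall r, A r -> c <= sval r f) -> c <= q f.
    move=> H; apply: lb_le_inf; first by exists (sval a f), a.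
    by move=> _ [r Ar <-]; exact: H.
  have qs : sublinear_on q.
    split=> [f g Sf Sg|c f c0 Sf].
      rewrite -lerBlDr; apply: (q_ge _ _) => r Ar; rewrite lerBlDr -lerBlDl.
      apply: (q_ge _ _) => s As; rewrite lerBlDl.
      have [u [Au [ur us]]] : exists u, A u /\
          (forall f, S f -> sval u f <= sval r f) /\
          (forall f, S f -> sval u f <= sval s f).
        have [/asboolP h|/asboolP h] := tA r s Ar As.
          by exists s; split => //; split => // *; exact: lexx.
        by exists r; split => //; split => // *; exact: lexx.
      apply: le_trans (q_le u _ Au (SD Sf Sg)) _.
      have := (svalP u).1.1 f g Sf Sg; have := ur f Sf; have := us g Sg; lra.
    rewrite -ler_pdivrMl//; apply: (q_ge _ _) => r Ar; rewrite ler_pdivrMl//.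
    apply: le_trans (q_le r _ Ar (SZ _ Sf)) _.
    exact: (svalP r).1.2.
  have qp0 f : S f -> q f <= p0 f.
    by move=> Sf; apply: le_trans (q_le a f Aa Sf) _; exact: (svalP a).2.
  by exists (exist _ q (conj qs qp0)) => s As; apply/asboolP => f Sf; exact: q_le.
have qD f g : S f -> S g -> q (f + g) = q f + q g.
  move=> Sf Sg; apply/eqP; rewrite eq_le qs.1//=.
  have sh_le h : S h -> shear q f h <= q h.
    move=> Sh; have := shear_le qs Sf Sh (lexx 0).
    by rewrite scale0r addr0 mul0r subr0.
  have shP : sublinear_on (shear q f) /\ forall h, S h -> shear q f h <= p0 h.
    split; first exact: shear_sublinear.
    by move=> h Sh; rewrite (le_trans (sh_le h Sh)) ?qp0.
  have /asboolP/(_ g Sg)/= : le (exist _ _ shP) (exist _ q (conj qs qp0)).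
    by apply: qmax; apply/asboolP.
  move=> /le_trans/(_ (shear_le qs Sf Sg ler01)).
  by rewrite scale1r mul1r (addrC g); lra.
have qN f : S f -> q (- f) = - q f.
  move=> Sf; have := qD f (- f) Sf (SN Sf).
  by rewrite subrr (sublinear0 qs Sf) => /eqP; rewrite eq_sym addrC addr_eq0 => /eqP.
exists q; split => //.
- move=> c f Sf; have [c0|c0] := leP 0 c; first exact: sublinearZ.
  rewrite -{1}(opprK c) scaleNr qN; last exact: SZ.
  by rewrite sublinearZ// ?mulNr ?opprK// oppr_ge0 ltW.
- by move=> f Sf; rewrite (le_trans (qp0 _ Sf)) ?p0p.
apply/eqP; rewrite eq_le (le_trans (qp0 _ Sf0)) ?p0p//=.
rewrite -lerN2 -qN//; apply: le_trans (qp0 _ (SN Sf0)) _.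
apply: le_trans (shear_le ps Sf0 (SN Sf0) ler01) _.
by rewrite scale1r addNr (sublinear0 ps Sf0) mul1r sub0r.
Qed.

End HahnBanach.

(** * The Riesz representation theorem *)

Lemma sum_slices {R : realFieldType} (y : R) n : 0 <= y ->
  \sum_(k < n) Num.min 1 (Num.max 0 (y - k%:R)) = Num.min y n%:R.
Proof.
move=> y0; elim: n => [|n IH]; first by rewrite big_ord0 min_r.
rewrite big_ord_recr/= IH -(natr1 n).
have [h|h] := leP y n%:R.
  by rewrite max_l ?subr_le0// min_r ?ler01// addr0 min_l// ler_wpDr.
rewrite max_r ?subr_ge0 1?ltW//.
by have [h1|h1] := leP 1 (y - n%:R); [rewrite min_r//|rewrite min_l//]; lra.
Qed.

Lemma lee_eps {R : realType} (x y : \bar R) :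
  (forall e : R, 0 < e -> (x <= y + e%:E)%E) -> (x <= y)%E.
Proof. by move=> H; apply/lee_addgt0Pr. Qed.

Section RieszMeasure.
Context {R : realType} {T : ptopologicalType} (X : set T).
Hypothesis cptX : compact X.
Hypothesis closedX : closed X.
(* This property of metric spaces provides the continuous functions that
   approximate indicators of open sets. *)
Hypothesis cozero : forall U : set T, open U -> exists2 d : T -> R,
  continuous d & forall x, 0 <= d x /\ (U x <-> 0 < d x).
Notation C f := ({within X, continuous (f : T -> R)}).
Variable L : (T -> R) -> R.
Hypothesis LD : forall f g, C f -> C g -> L (fun x => f x + g x) = L f + L g.
Hypothesis LZ : forall c f, C f -> L (fun x => c * f x) = c * L f.
Hypothesis L_le : forall f g, C f -> C g -> (forall x, X x -> f x <= g x) -> L f <= L g.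
Hypothesis L1 : L (fun=> 1) = 1.

Let Lcst c : L (fun=> c) = c.
Proof.
have := LZ c (@within_cont_cst R T X 1); rewrite L1 mulr1 => {2}<-.
by congr L; apply/funext => x; rewrite mulr1.
Qed.

Let Lsum n (F : nat -> T -> R) : (forall k, C (F k)) ->
  L (fun x => \sum_(k < n) F k x) = \sum_(k < n) L (F k).
Proof.
move=> cF; elim: n => [|n IH].
  by rewrite big_ord0 -[RHS](Lcst 0); congr L; apply/funext => x; rewrite big_ord0.
rewrite big_ord_recr/= -IH -LD//; last exact: within_cont_sum.
by congr L; apply/funext => x; rewrite big_ord_recr.
Qed.

Definition below (U : set T) (f : T -> R) := C f /\
  forall x, X x -> [/\ 0 <= f x, f x <= 1 & ~ U x -> f x = 0].

(** Functions that vanish off [U] are used instead of functions with compact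
    support in [U]; when open sets are cozero sets the supremum is the same. *)
Definition inner_content (U : set T) : \bar R :=
  ereal_sup [set (L f)%:E | f in below U].

Definition riesz_outer (A : set T) : \bar R :=
  ereal_inf [set inner_content U | U in [set U | open U /\ A `<=` U]].

Local Notation m0 := inner_content.
Local Notation m := riesz_outer.
Local Open Scope ereal_scope.

Let m0_ub U f : below U f -> (L f)%:E <= m0 U.
Proof. by move=> bf; apply: ereal_sup_ubound; exists f. Qed.

Let m0_lub U a : (forall f, below U f -> (L f)%:E <= a) -> m0 U <= a.
Proof. by move=> H; apply: ge_ereal_sup => _ [f bf <-]; exact: H. Qed.

Let below0 U : below U (fun=> 0%R).
Proof. by split=> [|x _]; [exact: within_cont_cst|split]. Qed.

Let m0_ge0 U : 0 <= m0 U.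
Proof. by rewrite -[0](congr1 EFin (Lcst 0)); apply: m0_ub; exact: below0. Qed.

Let m0_le1 U : m0 U <= 1.
Proof.
apply: m0_lub => f [cf bf]; rewrite lee_fin -L1; apply: L_le => //.
  exact: within_cont_cst.
by move=> x /bf[].
Qed.

Let m0_le U V : U `&` X `<=` V -> m0 U <= m0 V.
Proof.
move=> UV; apply: m0_lub => f [cf bf]; apply: m0_ub; split => // x Xx.
by have [? ? f0] := bf x Xx; split => // nV; apply: f0 => /= Ux; exact/nV/UV.
Qed.

Let m0_disj U : U `&` X `<=` set0 -> m0 U = 0.
Proof.
move=> UX; apply/eqP; rewrite eq_le m0_ge0 andbT; apply: m0_lub => f [cf bf].
rewrite lee_fin -(Lcst 0); apply: L_le => //; first exact: within_cont_cst.
by move=> x Xx; have [_ _ ->//] := bf x Xx => Ux; exact: (UX x).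
Qed.

(** Dini's argument replaces a partition of unity: the functions
    [min 1 (k d)], for [d] a cozero function of [F i], increase to the
    indicator of [F i] as [k] grows, so finitely many of them dominate [f] up
    to [e] on the compact set [X]. *)
Let m0_bigcup (F : (set T)^nat) : (forall i, open (F i)) ->
  m0 (\bigcup_i F i) <= \sum_(i <oo) m0 (F i).
Proof.
move=> oF; apply: m0_lub => f [cf bf]; apply: lee_eps => e e0.
have /choice[d dP] i : exists d : T -> R, continuous d /\
    forall x, (0 <= d x)%R /\ (F i x <-> (0 < d x)%R).
  by have [d ? ?] := cozero (oF i); exists d.
pose h n i x := Num.min 1%R (n%:R * d i x)%R.
have ch n i : C (h n i).
  apply: within_cont_min; first exact: within_cont_cst.
  by apply: within_contZ; apply: continuous_subspaceT; exact: (dP i).1.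
have h0 n i x : (0 <= h n i x)%R.
  by rewrite le_min ler01 mulr_ge0 ?ler0n//; exact: ((dP i).2 x).1.
have hb n i : below (F i) (h n i).
  split=> // x Xx; split; rewrite ?h0//; first by rewrite ge_min lexx.
  have [d0 dF] := (dP i).2 x.
  move=> nF; rewrite /h; suff -> : d i x = 0%R by rewrite mulr0 min_r.
  by apply/eqP; rewrite eq_le d0 andbT leNgt; apply/negP => /dF.
have [N HN] : exists N, forall n, (N <= n)%N -> forall x, X x -> X x ->
    (f x <= \sum_(i < n) h n i x + e)%R.
  apply: compact_eventually => // x Xx; have [f0 f1 fU] := bf x Xx.
  have [fe|fe] := ltP (f x) e.
    exists 0%N; have := within_cont_lt cf Xx fe.
    apply: filterS => y fy n _ Xy; rewrite -[leLHS]add0r lerD//; last exact/ltW/fy.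
    by rewrite sumr_ge0.
  have [i _ Fi] : (\bigcup_i F i) x.
    by apply: contrapT => /fU fx0; move: fe; rewrite fx0; lra.
  have dx : (0 < d i x)%R by apply/((dP i).2 x).2.
  have [N hN] : exists N : nat, ((d i x / 2)^-1 <= N%:R)%R.
    exists (Num.truncn (d i x / 2)^-1).+1; exact/ltW/truncnS_gt.
  exists (maxn i.+1 N); have /cvgrPdist_lt := (dP i).1 x.
  move=> /(_ (d i x / 2)%R); rewrite divr_gt0// => /(_ isT).
  apply: filterS => y dy n; rewrite geq_max => /andP[ni nN] Xy.
  rewrite (bigD1 (Ordinal ni))//= /h min_l.
    have [_ fy _] := bf y Xy; rewrite -addrA -[leLHS]addr0 lerD//.
    by apply: addr_ge0; [apply: sumr_ge0 => j _; exact: h0|exact: ltW].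
  have {}dy : (d i x / 2 <= d i y)%R by move: dy; rewrite ltr_norml => /andP[]; lra.
  rewrite -[leLHS](@mulVf _ (d i x / 2)) ?gt_eqF ?divr_gt0//.
  rewrite ler_pM ?invr_ge0 ?divr_ge0 ?(ltW dx)//.
  by rewrite (le_trans hN)// ler_nat.
have cs : C (fun x => \sum_(i < N) h N i x)%R by exact: within_cont_sum.
apply: (@le_trans _ _ (L (fun x => \sum_(i < N) h N i x + e)%R)%:E).
  rewrite lee_fin; apply: L_le => //.
    by apply: within_contD => //; exact: within_cont_cst.
  by move=> x Xx; exact: (HN N).
rewrite (LD cs (@within_cont_cst R T X e)) Lcst Lsum// EFinD leeD2r//.
rewrite (le_trans _ (nneseries_lim_ge N _))// big_mkord -sumEFin.
by apply: lee_sum => i _; exact: m0_ub.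
Qed.

Let m_lb A U : open U -> A `<=` U -> m A <= m0 U.
Proof. by move=> oU AU; apply: ereal_inf_lbound; exists U. Qed.

Let m_open U : open U -> m U = m0 U.
Proof.
move=> oU; apply/eqP; rewrite eq_le m_lb//=; apply: le_ereal_inf_tmp.
by move=> _ [V [oV UV] <-]; apply: m0_le => x [/UV].
Qed.

Let m_ge0 A : 0 <= m A.
Proof. by apply: le_ereal_inf_tmp => _ [V _ <-]; exact: m0_ge0. Qed.

Let m_le1 A : m A <= 1.
Proof. by apply: le_trans (m0_le1 setT); apply: m_lb => //; exact: openT. Qed.

Let m_le : {homo m : A B / A `<=` B >-> A <= B}.
Proof.
move=> A B AB; apply: le_ereal_inf_tmp => _ [V [oV BV] <-]; apply: m_lb => //.
exact: subset_trans BV.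
Qed.

Let m_fin A : m A \is a fin_num.
Proof. by rewrite ge0_fin_numE//; apply: le_lt_trans (m_le1 A) (ltry _). Qed.

Let m_approx A (e : R) : (0 < e)%R ->
  exists U, [/\ open U, A `<=` U & m0 U <= m A + e%:E].
Proof.
move=> e0; have [_ [U [oU AU] <-] h] := lb_ereal_inf_adherent e0 (m_fin A).
by exists U; split => //; exact: ltW.
Qed.

Let m_set0 : m set0 = 0.
Proof. by rewrite m_open; [apply: m0_disj => x []|exact: open0]. Qed.

Let m_sigma_subadditive : sigma_subadditive m.
Proof.
move=> F; apply: lee_eps => e e0.
apply: le_trans (epsilon_trick xpredT (fun n => m_ge0 (F n)) (ltW e0)).
have /choice[U UP] n : exists U, [/\ open U, F n `<=` U &
    m0 U <= m (F n) + (e / (2 ^ n.+1)%:R)%:E].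
  by apply: m_approx; rewrite divr_gt0// ltr0n expn_gt0.
apply: (@le_trans _ _ (m0 (\bigcup_n U n))).
  apply: m_lb; first by apply: bigcup_open => n _; have [] := UP n.
  by move=> x [n _ Fx]; exists n => //; have [_ FU _] := UP n; exact: FU.
apply: le_trans (m0_bigcup _) _; first by move=> n; have [] := UP n.
by apply: lee_nneseries => // n _; have [] := UP n.
Qed.

HB.instance Definition _ := isOuterMeasure.Build R T m
  m_set0 m_ge0 m_le m_sigma_subadditive.

(** Let [f] be nearly optimal below [V `&` U] and [g] be nearly optimal below
    [V] minus the closed set where [f >= e].  The sum of [g] and the positive
    part of [f - e] is still below [V], since where one is nonzero the other
    vanishes; so the contents of the two parts add up to at most that of [V]. *)
Let m_open_caratheodory U : open U -> m.-caratheodory U.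
Proof.
move=> oU; apply: le_caratheodory_measurable => Y; apply: le_ereal_inf_tmp.
move=> _ [V [oV YV] <-].
apply: (@le_trans _ _ (m0 (V `&` U) + m (V `&` ~` U))).
  apply: leeD; last by apply: m_le; exact: setSI.
  by apply: m_lb; [exact: openI|exact: setSI].
rewrite -leeBrDr//; apply: m0_lub => f [cf bf].
rewrite leeBrDr// -leeBrDl//; apply: lee_eps => e e0.
pose W := V `&` ~` [set x | X x /\ (e <= f x)%R].
have oW : open W.
  by apply: openI => //; apply: closed_openC; exact: within_cont_closed_ge.
apply: (@le_trans _ _ (m0 W)).
  apply: m_lb => // x [Vx nUx]; split=> // -[Xx].
  by have [_ _ ->] := bf x Xx; [rewrite leNgt e0|case].
apply: m0_lub => g [cg bg]; rewrite addeAC leeBrDr// -EFinD.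
pose k x := (Num.max (f x - e) 0 + g x)%R.
have cfe : C (fun x => f x - e)%R by apply: within_contD => //; exact: within_cont_cst.
have ck : C k.
  by apply: within_contD => //; apply: within_cont_max => //; exact: within_cont_cst.
have : below V k.
  split=> // x Xx; have [f0 f1 fV] := bf x Xx; have [g0 g1 gW] := bg x Xx.
  rewrite /k; have [fe|fe] := leP e (f x).
    rewrite gW; last by move=> [_]; apply.
    by rewrite addr0 max_l; [split; [lra|lra|move=> nV; rewrite fV in fe *; [lra|case]]|lra].
  rewrite max_r ?add0r; last lra.
  by split => // nV; apply: gW => -[].
move=> /m0_ub h; apply: le_trans (leeD2r e%:E h).
rewrite -EFinD lee_fin /k LD//; last first.
  by apply: within_cont_max => //; exact: within_cont_cst.
rewrite addrC addrAC lerD2r -lerBlDr -{1}(Lcst e) -mulN1r -(LZ _ (@within_cont_cst R T X e)).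
rewrite -LD//; last by apply: within_contZ; exact: within_cont_cst.
apply: L_le => [||x _]; last by rewrite mulN1r le_max lexx.
- by apply: within_contD => //; apply: within_contZ; exact: within_cont_cst.
- by apply: within_cont_max => //; exact: within_cont_cst.
Qed.

Let borel_caratheodory (A : set (borel T)) : measurable A -> m.-caratheodory A.
Proof.
move: A; apply: smallest_sub; last exact: m_open_caratheodory.
split=> [|A|F]; first exact: caratheodory_measurable_set0.
  by rewrite setTD; exact: caratheodory_measurable_setC.
exact: caratheodory_measurable_bigcup.
Qed.

Let riesz_measure (A : set (borel T)) : \bar R := m A.

Let riesz_sigma_additive : semi_sigma_additive riesz_measure.
Proof.
move=> F mF tF mUF; apply: (@caratheodory_measure_sigma_additive _ _ m F) => //.
  by move=> i; exact: borel_caratheodory.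
exact: borel_caratheodory.
Qed.

HB.instance Definition _ := isMeasure.Build _ _ _ riesz_measure
  m_set0 m_ge0 riesz_sigma_additive.

Let riesz_measureT : riesz_measure setT = 1.
Proof.
apply/eqP; rewrite eq_le m_le1/= /riesz_measure m_open; last exact: openT.
rewrite -[1](congr1 EFin L1); apply: m0_ub; split; first exact: within_cont_cst.
by move=> x _; split => // -[].
Qed.

HB.instance Definition _ := Measure_isProbability.Build _ _ _ riesz_measure
  riesz_measureT.

Let mu : probability (borel T) R := riesz_measure.

Let muE A : mu A = m A. Proof. by []. Qed.

Let mu_setCX : mu (~` X) = 0.
Proof.
rewrite muE m_open; last exact: closed_openC.
by apply: m0_disj => x [].
Qed.

Let muX : mu X = 1.
Proof.
have mX : measurable (X : set (borel T)) by exact: closed_borel.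
have := probability_setC mu (measurableC mX); rewrite setCK => ->.
by rewrite [X in _ - X](_ : _ = 0)// sube0.
Qed.

(** Outer regularity is built into [m]; inner regularity of a set follows from
    outer regularity of its complement, as [mu] is carried by [X]. *)
Let mu_regular : regular_measure mu.
Proof.
move=> A mA; split.
  rewrite muE /riesz_outer; congr ereal_inf; apply/seteqP.
  by split=> _ [U [oU AU] <-]; exists U => //; rewrite muE m_open.
apply/eqP; rewrite eq_le; apply/andP; split; last first.
  by apply: ge_ereal_sup => _ [K [_ KA] <-]; exact: m_le.
apply: lee_eps => e e0.
have [U [oU AU mU]] := m_approx (~` A) e0.
pose K := X `&` ~` U.
have clK : closed K by apply: closedI => //; exact: open_closedC.
have KA : K `<=` A by move=> x [_ nU]; apply: contrapT => /AU.
apply: (@le_trans _ _ (mu K + e%:E)); last first.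
  apply: leeD2r; apply: ereal_sup_ubound; exists K => //; split => //.
  by apply: compact_closedI => //; exact: open_closedC.
have h : 1 <= m K + m U.
  rewrite -riesz_measureT; apply: le_trans (outer_measureU2 m K U).
  apply: (@le_trans _ _ (m (K `|` U) + m (~` X))).
    apply: le_trans (outer_measureU2 m _ _); apply: m_le => x _.
    have [Ux|nU] := pselect (U x); first by left; right.
    by have [Xx|nX] := pselect (X x); [left; left|right].
  by rewrite -(muE (~` X)) mu_setCX adde0.
have : m A + m (~` A) = 1.
  rewrite -riesz_measureT; have := borel_caratheodory mA setT.
  by rewrite !setTI => <-.
move: h mU; rewrite -m_open// !muE.
move: (m_fin A) (m_fin K) (m_fin U) (m_fin (~` A)).
move: (m A) (m K) (m U) (m (~` A)) => [a||]// [k||]// [b||]// [c||]// _ _ _ _.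
by rewrite -!EFinD !lee_fin => h1 h2 [h3]; lra.
Qed.

Let m_fine f : C f -> mu.-integrable X (EFin \o f).
Proof. exact: within_cont_integrable. Qed.

Let I f := (\int[mu]_(x in X) f x)%R.

Let I_sum n (F : nat -> T -> R) : (forall k, C (F k)) ->
  I (fun x => \sum_(k < n) F k x)%R = (\sum_(k < n) I (F k))%R.
Proof.
have mX : measurable (X : set (borel T)) by exact: closed_borel.
move=> cF; elim: n => [|n IH].
  rewrite big_ord0 /I; under eq_Rintegral do rewrite big_ord0.
  by rewrite Rintegral_cst// mul0r.
rewrite big_ord_recr/= -IH /I; under eq_Rintegral do rewrite big_ord_recr/=.
by rewrite RintegralD//; apply: m_fine => //; exact: within_cont_sum.
Qed.

(** A function with values between 0 and 1 is the average of [n.+1] slices with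
    values between 0 and 1.  Each slice is below the open set where [f] exceeds
    its lower level, and the previous slice equals 1 there; so passing from [L]
    to the integral costs a shift by one slice, an error of [1 / n.+1]. *)
Let L_le_int01 f : C f -> (forall x, X x -> (0 <= f x <= 1)%R) -> (L f <= I f)%R.
Proof.
move=> cf f01.
have mX : measurable (X : set (borel T)) by exact: closed_borel.
suff key n : (n.+1%:R * L f <= 1 + n.+1%:R * I f)%R.
  rewrite leNgt; apply/negP => fI.
  have /(_ (Num.truncn (L f - I f)^-1)) := key.
  have := truncnS_gt (L f - I f)^-1%R.
  set N : R := _.+1%:R => h1 h2.
  have : (1 < N * (L f - I f))%R by rewrite -ltr_pdivrMr ?subr_gt0// div1r.
  by rewrite mulrBr; lra.
pose s k x := Num.min 1%R (Num.max 0 (n.+1%:R * f x - k%:R))%R.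
have cs k : C (s k).
  apply: within_cont_min; first exact: within_cont_cst.
  apply: within_cont_max; first exact: within_cont_cst.
  by apply: within_contD; [exact: within_contZ|exact: within_cont_cst].
have s0 k x : (0 <= s k x)%R by rewrite le_min ler01 le_max lexx.
have s1 k x : (s k x <= 1)%R by rewrite ge_min lexx.
have sumE x : X x -> (\sum_(k < n.+1) s k x = n.+1%:R * f x)%R.
  move=> /f01/andP[f0 f1]; rewrite sum_slices ?mulr_ge0//.
  by rewrite min_l// ler_piMr.
have step k : (L (s k.+1) <= I (s k))%R.
  pose U := ~` [set x | X x /\ (- k.+1%:R <= - n.+1%:R * f x)%R].
  have oU : open U by apply: closed_openC; apply: within_cont_closed_ge => //; exact: within_contZ.
  have mU : measurable (U : set (borel T)) by exact: open_borel.
  have bs : below U (s k.+1).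
    split=> // x Xx; split => //; rewrite /U/= => /contrapT[_ h].
    by rewrite /s max_l ?min_r//; lra.
  rewrite -lee_fin; apply: le_trans (m0_ub bs) _.
  rewrite -m_open// -muE.
  apply: (@le_trans _ _ (mu (U `&` X))).
    rewrite -[leRHS]adde0 -mu_setCX; apply: le_trans (outer_measureU2 m _ _).
    apply: m_le => x Ux; have [Xx|nX] := pselect (X x); first by left.
    by right.
  rewrite -integral_indic// /I /Rintegral fineK; last first.
    by apply: integrable_fin_num => //; exact: m_fine.
  apply: ge0_le_integral => //.
  - by apply/measurable_EFinP; exact: measurable_indic.
  - by apply/measurable_EFinP; exact: within_cont_measurable.
  move=> x Xx; rewrite lee_fin indicE; case: (boolP (x \in U)) => [|_]; last exact: s0.
  rewrite inE /U/= => h; have {}h : (k.+1%:R < n.+1%:R * f x)%R.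
    by rewrite ltNge; apply/negP => h'; apply: h; split => //; lra.
  by rewrite /s min_l// le_max; apply/orP; right; move: h; rewrite -(natr1 k); lra.
have -> : (n.+1%:R * L f = \sum_(k < n.+1) L (s k))%R.
  rewrite -Lsum// -LZ//; apply/eqP; rewrite eq_le.
  by apply/andP; split; apply: L_le => //; try exact: within_contZ;
    try exact: within_cont_sum; move=> x /sumE ->.
have -> : (n.+1%:R * I f = \sum_(k < n.+1) I (s k))%R.
  rewrite -I_sum// /I -RintegralZl//; last exact: m_fine.
  by apply: eq_Rintegral => x /set_mem/sumE ->.
rewrite big_ord_recl [X in (_ <= 1 + X)%R]big_ord_recr/= lerD//.
  by rewrite -[leRHS]L1; apply: L_le => //; exact: within_cont_cst.
rewrite -[leLHS]addr0 lerD//; last by apply: Rintegral_ge0 => x _; exact: s0.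
by apply: ler_sum => k _; exact: step.
Qed.

Let L_le_int f : C f -> (L f <= I f)%R.
Proof.
move=> cf; have [B B0 fB] := within_cont_bounded cptX cf.
have mX : measurable (X : set (borel T)) by exact: closed_borel.
pose g x := ((2 * B)^-1 * (f x + B))%R.
have cfB : C (fun x => f x + B)%R by apply: within_contD => //; exact: within_cont_cst.
have B20 : (0 < 2 * B)%R by rewrite mulr_gt0.
have : (L g <= I g)%R.
  apply: L_le_int01; first exact: within_contZ.
  move=> x /fB; rewrite ler_norml /g => /andP[h1 h2].
  by rewrite ler_pdivrMl// mulr_ge0 ?invr_ge0 ?(ltW B20)//=; lra.
rewrite /g LZ// LD// ?Lcst; last exact: within_cont_cst.
rewrite /I RintegralZl//; last exact: m_fine.
rewrite RintegralD//; [|exact: m_fine|by apply: m_fine; exact: within_cont_cst].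
have -> : (\int[mu]_(x in X) B = B)%R by rewrite Rintegral_cst// [Z in fine Z](_ : _ = 1)//= mulr1.
by rewrite ler_pM2l ?invr_gt0// lerD2r.
Qed.

(** The inequality between [L] and the integral, used for both [f] and [- f],
    is an equality. *)
Lemma riesz_representation : exists mu : probability (borel T) R,
  [/\ regular_measure mu, mu X = 1 &
   forall f, C f -> \int[mu]_(x in X) (f x)%:E = (L f)%:E].
Proof.
exists mu; split; [exact: mu_regular|exact: muX|move=> f cf].
have mX : measurable (X : set (borel T)) by exact: closed_borel.
have -> : \int[mu]_(x in X) (f x)%:E = (I f)%:E.
  by rewrite /I /Rintegral fineK//; apply: integrable_fin_num => //; exact: m_fine.
congr EFin; apply/eqP; rewrite eq_le L_le_int// andbT.
have cNf : C (fun x => -1 * f x)%R by exact: within_contZ.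
have := L_le_int cNf; rewrite LZ// /I RintegralZl//; last exact: m_fine.
by rewrite !mulN1r lerN2.
Qed.

End RieszMeasure.

(** * Circle means and continuous plurisubharmonic functions *)

Section CircleMeans.
Context {R : realType} {n : nat}.
Local Notation V := 'rV[R[i]]_n.
Implicit Types (p b x y : V) (g h : V -> R) (U : set V).

Definition cis (t : R) : R[i] := (cos t +i* sin t)%C.

(** Discs in complex lines are parametrized by the closed unit disc of [R[i]],
    with an arbitrary direction vector [b]: the disc of radius [r] in direction
    [b] is the unit disc in direction [r *: b]. *)
Definition circle p b (t : R) : V := p + cis t *: b.

Definition disc_in U p b := forall w : R[i], nr w <= 1 -> U (p + w *: b).

Definition mean g p b : R :=
  (2 * pi)^-1 * \int[lebesgue_measure]_(t in `[0, 2 * pi]) g (circle p b t).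

Definition submean U g := forall p b, disc_in U p b -> g p <= mean g p b.

Lemma nr_complex_le (a c : R) : nr ((a +i* c)%C : R[i]) <= `|a| + `|c|.
Proof.
rewrite /nr normc_def /= -(@ler_pXn2r _ 2) ?nnegrE ?sqrtr_ge0 ?addr_ge0//.
rewrite sqr_sqrtr ?addr_ge0 ?sqr_ge0// sqrrD !real_normK ?num_real//.
by rewrite addrAC lerDl mulrn_wge0 // mulr_ge0.
Qed.

Lemma nrM (a c : R[i]) : nr (a * c) = nr a * nr c.
Proof. exact: (nrZ a c). Qed.

Lemma nr_real (r : R) : 0 <= r -> nr (r%:C%C : R[i]) = r.
Proof. by move=> r0; rewrite /nr normc_def/= expr0n addr0 sqrtr_sqr ger0_norm. Qed.

Lemma nr_cis (t : R) : nr (cis t) = 1.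
Proof. by rewrite /nr normc_def /= cos2Dsin2 sqrtr1. Qed.

Lemma cis0 : cis 0 = 1.
Proof. by rewrite /cis cos0 sin0. Qed.

Lemma cisD s t : cis (s + t) = cis s * cis t.
Proof.
rewrite /cis cosD sinD; apply/eqP; rewrite eq_complex /=.
by rewrite eqxx addrC eqxx.
Qed.

Lemma circle_in U p b t : disc_in U p b -> U (circle p b t).
Proof. by apply; rewrite nr_cis. Qed.

Lemma center_in U p b : disc_in U p b -> U p.
Proof. by move=> /(_ 0); rewrite nr0 ler01 scale0r addr0; exact. Qed.

Lemma line_continuous p b : continuous (fun w : R[i] => p + w *: b).
Proof.
move=> w A /nbhs_nr[e e0 H]; apply/nbhs_nr.
have b1 : 0 < nr b + 1 by rewrite ltr_wpDl ?nr_ge0.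
exists (e / (nr b + 1)); first by rewrite divr_gt0.
move=> z zw; apply: H; rewrite opprD addrACA subrr add0r -scalerBl nrZ.
rewrite ltr_pdivlMr// in zw; apply: le_lt_trans zw.
by rewrite ler_wpM2l ?nr_ge0// lerDl.
Qed.

Lemma cis_continuous : continuous cis.
Proof.
move=> t A /nbhs_nr[e e0 H]; have e2 : 0 < e / 2 by rewrite divr_gt0.
have /cvgrPdist_lt/(_ _ e2) hc := @continuous_cos R t.
have /cvgrPdist_lt/(_ _ e2) hs := @continuous_sin R t.
apply: filterS2 hc hs => s hc hs; apply: H.
apply: le_lt_trans (nr_complex_le _ _) _.
by rewrite -[X in X + _]normrN -[X in _ + X]normrN !opprB; lra.
Qed.

Lemma circle_continuous p b : continuous (circle p b).
Proof.
move=> t; apply: (@continuous_comp _ _ _ cis (fun w => p + w *: b)).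
  exact: cis_continuous.
exact: line_continuous.
Qed.

Lemma circle_comp_continuous U g p b : (forall x, U x -> {for x, continuous g}) ->
  disc_in U p b -> continuous (g \o circle p b).
Proof.
move=> cg dU t; apply: continuous_comp; first exact: circle_continuous.
by apply: cg; exact: circle_in.
Qed.

Definition circ_continuous g p b := continuous (g \o circle p b).

Lemma circle_integrable g p b : circ_continuous g p b ->
  lebesgue_measure.-integrable `[0, 2 * pi] (EFin \o (g \o circle p b)).
Proof.
move=> cg; apply: continuous_compact_integrable; first exact: segment_compact.
exact: continuous_subspaceT.
Qed.

Lemma mean_le g h p b : circ_continuous g p b -> circ_continuous h p b ->
  (forall t, g (circle p b t) <= h (circle p b t)) -> mean g p b <= mean h p b.
Proof.
move=> cg ch gh; rewrite ler_pM2l ?invr_gt0 ?mulr_gt0 ?pi_gt0//.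
by apply: le_Rintegral => //; exact: circle_integrable.
Qed.

Lemma mean_cst (c : R) p b : mean (fun=> c) p b = c.
Proof.
rewrite /mean Rintegral_cst//= lebesgue_measure_itv/= lte_fin mulr_gt0 ?pi_gt0//=.
by rewrite subr0 mulrCA mulVf ?mulr1// mulf_neq0// gt_eqF ?pi_gt0.
Qed.

Lemma meanD g h p b : circ_continuous g p b -> circ_continuous h p b ->
  mean (fun x => g x + h x) p b = mean g p b + mean h p b.
Proof.
move=> cg ch; rewrite /mean -mulrDr -RintegralD//.
  exact: (circle_integrable cg).
exact: (circle_integrable ch).
Qed.

Lemma meanZ c g p b : circ_continuous g p b ->
  mean (fun x => c * g x) p b = c * mean g p b.
Proof.
move=> cg; rewrite /mean RintegralZl//; first by rewrite mulrCA.
exact: (circle_integrable cg).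
Qed.

(** Continuous plurisubharmonic functions: [PSHoP] compares this with [psh],
    which asks for the sub-mean inequality on one complex line at a time. *)
Definition cpsh U g :=
  [/\ open U, forall x, U x -> {for x, continuous g} & submean U g].

Lemma cpsh_cst c : cpsh setT (fun=> c).
Proof.
split; [exact: openT|by move=> x _; apply: cst_continuous|].
by move=> p b _; rewrite mean_cst.
Qed.

Lemma disc_inS U U' p b : U `<=` U' -> disc_in U p b -> disc_in U' p b.
Proof. by move=> UU' dU w /dU/UU'. Qed.

Lemma cpshD U U' g h : cpsh U g -> cpsh U' h ->
  cpsh (U `&` U') (fun x => g x + h x).
Proof.
move=> [oU cg sg] [oU' ch sh]; split; first exact: openI.
  by move=> x [Ux U'x]; exact: (continuousD (cg x Ux) (ch x U'x)).
move=> p b d; have d1 := disc_inS (@subIsetl _ U U') d.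
have d2 := disc_inS (@subIsetr _ U U') d.
rewrite meanD; first exact: lerD (sg _ _ d1) (sh _ _ d2).
  exact: circle_comp_continuous cg d1.
exact: circle_comp_continuous ch d2.
Qed.

Lemma cpshZ U c g : 0 <= c -> cpsh U g -> cpsh U (fun x => c * g x).
Proof.
move=> c0 [oU cg sg]; split => //.
  by move=> x Ux; apply: continuousM; [apply: cst_continuous|exact: (cg x Ux)].
move=> p b d; rewrite meanZ ?ler_wpM2l ?sg//.
exact: circle_comp_continuous cg d.
Qed.

Lemma cpsh_max U U' g h : cpsh U g -> cpsh U' h ->
  cpsh (U `&` U') (fun x => Num.max (g x) (h x)).
Proof.
move=> [oU cg sg] [oU' ch sh].
have cm x : (U `&` U') x -> {for x, continuous (fun x => Num.max (g x) (h x))}.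
  by move=> [Ux U'x]; exact: (continuous_max (cg x Ux) (ch x U'x)).
split=> //; first exact: openI.
move=> p b d; have d1 := disc_inS (@subIsetl _ U U') d.
have d2 := disc_inS (@subIsetr _ U U') d.
rewrite ge_max; apply/andP; split.
  apply: le_trans (sg _ _ d1) _; apply: mean_le.
  - exact: circle_comp_continuous cg d1.
  - exact: circle_comp_continuous cm d.
  - by move=> t; rewrite le_max lexx.
apply: le_trans (sh _ _ d2) _; apply: mean_le.
- exact: circle_comp_continuous ch d2.
- exact: circle_comp_continuous cm d.
- by move=> t; rewrite le_max lexx orbT.
Qed.

(** Scaling the direction [b] absorbs the radius of the discs, so only unit
    discs have to be considered. *)
Lemma psh_submean U (u : V -> \bar R) p b : psh U u -> disc_in U p b ->
  (u p <= ((2 * pi)^-1)%:E *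
    \int[lebesgue_measure]_(t in `[0%R, (2 * pi)%R]) u (circle p b t))%E.
Proof.
move=> [_ /(_ p b)[_ /(_ 0 1 ltr01)]] H d.
move: H; rewrite scale0r addr0 => H.
have E : circle_mean (fun w => u (p + w *: b)) 0 1 = (((2 * pi)^-1)%:E *
    \int[lebesgue_measure]_(t in `[0%R, (2 * pi)%R]) u (circle p b t))%E.
  rewrite /circle_mean; apply: (congr1 (fun I => (((2 * pi)^-1)%:E * I)%E)).
  by under eq_integral do rewrite add0r mul1r.
rewrite -E; apply: H => w; rewrite subr0 nrE lecR => w1; exact: d.
Qed.

End CircleMeans.

Section ContinuousPsh.
Context {R : realType} {n : nat}.
Local Notation V := 'rV[R[i]]_n.
Implicit Types (p b x y : V) (g h : V -> R) (U X : set V).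

Lemma within_cont_open {T : topologicalType} (U : set T) (f : T -> R) :
  open U -> {within U, continuous f} <-> forall z : T, U z -> {for z, continuous f}.
Proof.
move=> oU; split=> [/within_contP cf x Ux|cf].
  apply/cvgrPdist_lt => e e0; have nU : \forall y \near x, U y.
    by apply: open_nbhs_nbhs; split.
  by apply: filterS2 nU (cf x Ux e e0) => y Uy /(_ Uy); rewrite distrC.
apply/within_contP => x Ux e e0; have /cvgrPdist_lt/(_ e e0) := cf x Ux.
by apply: filterS => y h _; rewrite distrC.
Qed.

Lemma mean_ereal g p b : circ_continuous g p b ->
  (((2 * pi)^-1)%:E * \int[lebesgue_measure]_(t in `[0%R, (2 * pi)%R])
    (g (circle p b t))%:E)%E = (mean g p b)%:E.
Proof.
move=> cg; rewrite /mean EFinM; apply: (congr1 (fun I => (((2 * pi)^-1)%:E * I)%E)).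
rewrite /Rintegral fineK//.
by apply: integrable_fin_num => //; exact: (circle_integrable cg).
Qed.

Lemma cpsh_psh U g : cpsh U g -> psh U (EFin \o g).
Proof.
move=> [oU cg sg]; have ug : usc_on U (EFin \o g).
  by apply: within_cont_usc; apply/within_cont_open.
split => // a b; split=> [w /= Uw|c r r0 H].
  split=> [|l]; first exact: ltry.
  move=> gl; have [_ /(_ l gl)] := ug _ Uw; rewrite !near_withinE => nl.
  exact: (@line_continuous R n a b w _ nl).
have d : disc_in U (a + c *: b) (r%:C%C *: b).
  move=> w w1; rewrite scalerA -addrA -scalerDl; apply: H.
  rewrite addrAC subrr add0r nrE lecR nrM (nr_real (ltW r0)).
  by rewrite -[leRHS]mul1r ler_pM2r.
have cc := circle_comp_continuous cg d.
have := sg _ _ d; rewrite -lee_fin -mean_ereal//; move=> /le_trans; apply.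
rewrite le_eqVlt; apply/orP; left; apply/eqP.
apply: (congr1 (fun I => (((2 * pi)^-1)%:E * I)%E)).
apply: eq_integral => t _ /=; congr (EFin (g _)).
by rewrite /circle scalerA -addrA -scalerDl (mulrC (cis t)).
Qed.

Lemma PSHoP X (u : V -> R) : PSHo X u <->
  exists U g, [/\ X `<=` U, cpsh U g & forall x, X x -> g x = u x].
Proof.
split=> [[U [g [oU XU pg cg gu]]]|[U [g [XU gp gu]]]]; exists U, g.
  have cg' := (within_cont_open g oU).1 cg.
  split => //; split => // p b d; have := psh_submean pg d.
  rewrite mean_ereal ?lee_fin//; exact: circle_comp_continuous cg' d.
have [oU cg _] := gp; split => //; first exact: cpsh_psh.
exact/within_cont_open.
Qed.

Lemma PSHo_cont X (u : V -> R) : PSHo X u -> {within X, continuous u}.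
Proof.
move=> /PSHoP[U [g [XU [oU cg _] gu]]]; apply/within_contP => x Xx e e0.
have /cvgrPdist_lt/(_ e e0) := cg x (XU x Xx).
by apply: filterS => y + Xy; rewrite !gu// distrC.
Qed.

Lemma PSHo_cst X (c : R) : PSHo X (fun=> c).
Proof. by apply/PSHoP; exists setT, (fun=> c); split => //; exact: cpsh_cst. Qed.

Lemma PSHoD X (u v : V -> R) : PSHo X u -> PSHo X v -> PSHo X (fun x => u x + v x).
Proof.
move=> /PSHoP[U [g [XU pg gu]]] /PSHoP[W [h [XW ph hv]]]; apply/PSHoP.
exists (U `&` W), (fun x => g x + h x); split; first by move=> x Xx; split; auto.
  exact: cpshD.
by move=> x Xx; rewrite gu ?hv.
Qed.

Lemma PSHoZ X (c : R) (u : V -> R) : 0 <= c -> PSHo X u -> PSHo X (fun x => c * u x).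
Proof.
move=> c0 /PSHoP[U [g [XU pg gu]]]; apply/PSHoP; exists U, (fun x => c * g x).
by split => //; [exact: cpshZ|move=> x Xx; rewrite gu].
Qed.

Lemma PSHo_max X (u v : V -> R) : PSHo X u -> PSHo X v ->
  PSHo X (fun x => Num.max (u x) (v x)).
Proof.
move=> /PSHoP[U [g [XU pg gu]]] /PSHoP[W [h [XW ph hv]]]; apply/PSHoP.
exists (U `&` W), (fun x => Num.max (g x) (h x)).
split; first by move=> x Xx; split; auto.
  exact: cpsh_max.
by move=> x Xx; rewrite gu ?hv.
Qed.

End ContinuousPsh.

(** * From local to global sub-mean inequalities *)

Section RealMean.
Context {R : realType}.
Implicit Types f : R -> R.
Local Notation mu := (@lebesgue_measure R).
Local Notation I a b f := (\int[mu]_(t in `[a, b]) f t).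

Let int_seg f a b : continuous f -> mu.-integrable `[a, b] (EFin \o f).
Proof.
move=> cf; apply: continuous_compact_integrable; first exact: segment_compact.
exact: continuous_subspaceT.
Qed.

Let int_cst (c a b : R) : a <= b -> I a b (fun=> c) = c * (b - a).
Proof.
move=> ab; rewrite Rintegral_cst//= lebesgue_measure_itv/= lte_fin.
by move: ab; rewrite le_eqVlt => /predU1P[->|ab]; rewrite ?ltxx ?ab/= ?subrr ?mulr0.
Qed.

Let int_split f a b c : continuous f -> a <= b -> b <= c ->
  I a c f = I a b f + \int[mu]_(t in `]b, c]) f t.
Proof.
move=> cf ab bc; have := @Rintegral_itvB R f (BLeft a) (BRight c) b (int_seg a c cf).
by rewrite !bnd_simp => /(_ ab bc) <-; rewrite addrC subrK.
Qed.

Lemma Rintegral_gt0 f (a b t0 : R) : a < b -> continuous f ->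
  (forall t, 0 <= f t) -> a <= t0 <= b -> 0 < f t0 -> 0 < I a b f.
Proof.
move=> ab cf f0 /andP[at0 t0b] ft0.
have e0 : 0 < f t0 / 2 by rewrite divr_gt0.
have /cvgrPdist_lt/(_ _ e0)/nbhs_ballP[d /= d0 Hd] := cf t0.
pose c := Num.max a (t0 - d / 2); pose c' := Num.min b (t0 + d / 2).
have cc' : c < c'.
  rewrite /c /c' lt_min !gt_max -!andbA; apply/and4P; split; lra.
have sub : `[c, c'] `<=` `[a, b].
  move=> t /=; rewrite !in_itv/= /c /c' ge_max le_min.
  by move=> /andP[/andP[-> _] /andP[-> _]].
apply: (@lt_le_trans _ _ (I c c' (fun=> f t0 / 2))).
  by rewrite int_cst ?ltW// mulr_gt0// subr_gt0.
apply: (@le_trans _ _ (I c c' f)).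
  apply: le_Rintegral => //; try exact: int_seg.
    by apply: int_seg => x; exact: cvg_cst.
  move=> t; rewrite /= in_itv/= /c /c' ge_max le_min.
  move=> /andP[/andP[_ h1] /andP[_ h2]].
  have : `|f t0 - f t| < f t0 / 2.
    by apply: Hd; rewrite /ball/= ltr_norml; lra.
  by rewrite ltr_norml; lra.
rewrite -lee_fin /Rintegral !fineK; try by apply: integrable_fin_num => //; exact: int_seg.
apply: ge0_subset_integral => //; last by move=> t _; rewrite lee_fin.
by apply: (measurable_int mu); exact: int_seg.
Qed.

Lemma int_sum (F : nat -> R -> R) N a b : (forall k, continuous (F k)) ->
  I a b (fun t => \sum_(k < N) F k t) = \sum_(k < N) I a b (F k).
Proof.
move=> cF; have cS M : continuous (fun t => \sum_(k < M) F k t).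
  elim: M => [|M IH].
    rewrite (_ : (fun t => _) = fun=> 0); first by move=> x; exact: cvg_cst.
    by apply/funext => t; rewrite big_ord0.
  rewrite (_ : (fun t => _) = fun t => \sum_(k < M) F k t + F M t).
    by move=> x; apply: cvgD; [exact: IH|exact: cF].
  by apply/funext => t; rewrite big_ord_recr.
elim: N => [|N IH].
  rewrite big_ord0; under eq_Rintegral do rewrite big_ord0.
  by rewrite Rintegral_cst//= mul0r.
rewrite big_ord_recr/= -IH.
under [LHS]eq_Rintegral do rewrite big_ord_recr/=.
by rewrite RintegralD//; apply: int_seg => //; exact: cS.
Qed.

(** The nonnegative continuous function [c - f] has integral at most 0 over the
    period, so it vanishes there. *)
Lemma mean_eq_max f c : continuous f -> (forall t, f t <= c) ->
  c <= (2 * pi)^-1 * I 0 (2 * pi) f -> forall t, 0 <= t <= 2 * pi -> f t = c.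
Proof.
move=> cf fc; have p0 : 0 < 2 * pi :> R by rewrite mulr_gt0 ?pi_gt0.
rewrite ler_pdivlMl// => h t t02; apply/eqP; rewrite eq_le fc/= leNgt; apply/negP => ftc.
have ccf : continuous (fun t => c - f t).
  by move=> x; apply: cvgB; [exact: cvg_cst|exact: cf].
have : 0 < I 0 (2 * pi) (fun t => c - f t).
  apply: (@Rintegral_gt0 _ _ _ t) => //; first by move=> s; rewrite subr_ge0.
  by rewrite subr_gt0.
rewrite RintegralB//; try exact: int_seg; last by apply: int_seg => x; exact: cvg_cst.
by rewrite int_cst ?ltW// subr0; lra.
Qed.

Lemma riemann_lower f (h : R) (s : nat -> R) N : continuous f -> 0 <= h ->
  (forall k t, (k < N)%N -> k%:R * h <= t <= k.+1%:R * h -> s k <= f t) ->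
  (\sum_(k < N) s k) * h <= I 0 (N%:R * h) f.
Proof.
move=> cf h0; elim: N => [|N IH] H.
  by rewrite big_ord0 !mul0r set_itv1 Rintegral_set1.
have bc : N%:R * h <= N.+1%:R * h by rewrite ler_wpM2r// ler_nat.
rewrite big_ord_recr/= mulrDl (@int_split f 0 (N%:R * h))//; last first.
  by rewrite mulr_ge0.
apply: lerD; first by apply: IH => k t kN; apply: H; exact: ltnW.
have -> : s N * h = \int[mu]_(t in `]N%:R * h, N.+1%:R * h]) (s N).
  rewrite Rintegral_cst//= lebesgue_measure_itv/= lte_fin -(natr1 N).
  case: ltP => h1 /=; first by rewrite mulrDl mul1r addrC addKr.
  by have -> : h = 0; [apply/eqP; rewrite eq_le h0 andbT; lra|rewrite !mulr0].
have sub : `]N%:R * h, N.+1%:R * h] `<=` `[N%:R * h, N.+1%:R * h].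
  by move=> t /=; rewrite !in_itv/= => /andP[/ltW -> ->].
have sub_int f' : continuous f' ->
    mu.-integrable `]N%:R * h, N.+1%:R * h] (EFin \o f').
  by move=> cf'; have := @int_seg f' (N%:R * h) (N.+1%:R * h) cf'; apply: integrableS.
apply: le_Rintegral => //.
- by apply: sub_int => x; exact: cvg_cst.
- exact: sub_int.
- by move=> t /sub/=; rewrite in_itv/=; exact: H.
Qed.

(** For large [N], uniform continuity makes the sums over the vertices of an
    inscribed polygon approximate Riemann sums of the integral. *)
Lemma mean_ge_polygons f (c : R) : continuous f -> periodic f (pi *+ 2) ->
  (forall N, exists2 th, 0 <= th <= 2 * pi &
    c * N.+1%:R <= \sum_(k < N.+1) f (th + k%:R * (2 * pi / N.+1%:R))) ->
  c <= (2 * pi)^-1 * I 0 (2 * pi) f.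
Proof.
move=> cf pf H; have p0 : 0 < 2 * pi :> R by rewrite mulr_gt0 ?pi_gt0.
rewrite ler_pdivlMl//; apply/ler_addgt0Pr => e' e'0.
pose e : R := e' / (2 * pi); have e0 : 0 < e by rewrite divr_gt0.
have e2 : 0 < e / 2 by rewrite divr_gt0.
have [N0 HN0] : exists N0, forall N, (N0 <= N)%N -> forall t, `[0, 2 * pi]%classic t ->
    forall s, `|s - t| <= 2 * pi / N.+1%:R -> `|f s - f t| < e.
  apply: compact_eventually; first exact: segment_compact.
  move=> t _; have /cvgrPdist_lt/(_ _ e2)/nbhs_ballP[d /= d0 Hd] := cf t.
  exists (Num.truncn ((d / 2)^-1 * (2 * pi))); apply/nbhs_ballP.
  exists (d / 2) => /=; first by rewrite divr_gt0.
  move=> y; rewrite /ball/= => yt N NN s sy.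
  have hN : 2 * pi / N.+1%:R < d / 2.
    rewrite ltr_pdivrMr// -ltr_pdivrMl ?divr_gt0//.
    by apply: lt_le_trans (truncnS_gt _) _; rewrite ler_nat.
  have {}sy := le_lt_trans sy hN.
  have h1 : `|f t - f y| < e / 2 by apply: Hd; rewrite /ball/=; clear -yt d0; lra.
  have h2 : `|f t - f s| < e / 2.
    apply: Hd; rewrite /ball/=.
    have : `|t - s| <= `|t - y| + `|y - s|.
      by apply: le_trans (ler_normD _ _); rewrite addrA subrK.
    by rewrite (distrC y s); clear -yt sy d0; lra.
  have : `|f s - f y| <= `|f s - f t| + `|f t - f y|.
    by apply: le_trans (ler_normD _ _); rewrite addrA subrK.
  by rewrite (distrC (f s) (f t)); clear -h1 h2; lra.
set N := N0.+1; have {HN0} HN := HN0 N0 (leqnn _).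
pose h : R := 2 * pi / N%:R; have h0 : 0 < h by rewrite divr_gt0.
have Nh : N%:R * h = 2 * pi by rewrite mulrC divfK// pnatr_eq0.
have [th /andP[th0 _] Hth] := H N0.
(* The sum does not change when [th] is shifted by a multiple of [h], so the
   angle of the first vertex may be taken between 0 and [h]. *)
pose j := Num.truncn (th / h); pose th' := th - j%:R * h.
have /andP[th'0 th'h] : 0 <= th' <= h.
  have /andP[j1 j2] : j%:R <= th / h < j.+1%:R.
    by apply: truncn_itv; rewrite divr_ge0// ltW.
  rewrite ler_pdivlMr// in j1; rewrite ltr_pdivrMr// -(natr1 j) in j2.
  by rewrite /th'; apply/andP; split; lra.
have shift a : \sum_(k < N) f (a + h + k%:R * h) = \sum_(k < N) f (a + k%:R * h).
  rewrite [LHS]big_ord_recr [RHS]big_ord_recl/= mul0r addr0 addrC; congr (_ + _).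
    rewrite -[RHS]pf; congr f; rewrite -addrA; congr (_ + _).
    by move: Nh; rewrite /N -(natr1 N0) mulr2n mulrDl mul1r; lra.
  by apply: eq_bigr => k _; congr f; rewrite (_ : bump 0 k = k.+1)// -(natr1 k); ring.
have shiftj i a : \sum_(k < N) f (a + i%:R * h + k%:R * h) =
    \sum_(k < N) f (a + k%:R * h).
  elim: i a => [|i IH] a; first by under eq_bigr do rewrite mul0r addr0.
  rewrite -[RHS]IH -[RHS]shift; apply: eq_bigr => k _; congr f.
  by rewrite -(natr1 i); ring.
have th'E : \sum_(k < N) f (th' + k%:R * h) = \sum_(k < N) f (th + k%:R * h).
  by rewrite -(shiftj j); apply: eq_bigr => k _; rewrite /th' subrK.
pose s k := f (th' + k%:R * h) - e.
have := @riemann_lower f h s N cf (ltW h0); rewrite Nh => Hr.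
have : (\sum_(k < N) s k) * h <= I 0 (2 * pi) f.
  apply: Hr => k t kN /andP[t1 t2]; rewrite /s lerBlDr.
  have h01 : 0 <= k%:R * h by rewrite mulr_ge0// ltW.
  have h02 : k.+1%:R * h <= 2 * pi by rewrite -Nh ler_pM2r// ler_nat.
  rewrite -(natr1 k) mulrDl mul1r in t2 h02.
  have : `|f (th' + k%:R * h) - f t| < e.
    apply: HN; first by rewrite /= in_itv/=; lra.
    by rewrite -/h ler_norml; lra.
  by rewrite ltr_norml; lra.
rewrite /s sumrB sumr_const card_ord th'E.
have -> : (\sum_(k < N) f (th + k%:R * h) - e *+ N) * h =
    (\sum_(k < N) f (th + k%:R * h)) * h - e * (2 * pi).
  by rewrite -Nh -[e *+ N]mulr_natr; ring.
have -> : e * (2 * pi) = e' by rewrite /e divfK// gt_eqF.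
move=> hI; have : c * (2 * pi) <= (\sum_(k < N) f (th + k%:R * h)) * h.
  by rewrite -Nh mulrA ler_pM2r.
by rewrite (mulrC c); lra.
Qed.

End RealMean.

Section Polar.
Context {R : realType}.

Definition polar (z : R * R) : R[i] := z.1%:C%C * cis z.2.

Lemma nr_polar z : 0 <= z.1 -> nr (polar z) = z.1.
Proof. by move=> z0; rewrite nrM nr_cis mulr1 nr_real. Qed.

Lemma polar_cis r t s : polar (r, t + s) = polar (r, t) * cis s.
Proof. by rewrite /polar/= cisD mulrA. Qed.

Lemma polarDr r s t : polar (r + s, t) = polar (r, t) + s%:C%C * cis t.
Proof. by rewrite /polar/= rmorphD mulrDl. Qed.

Lemma polarE z : polar z = (z.1 * cos z.2 +i* (z.1 * sin z.2))%C.
Proof.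
by apply/eqP; rewrite /polar /cis eq_complex /= !mul0r subr0 addr0 !eqxx.
Qed.

Lemma polar_continuous : continuous polar.
Proof.
move=> z A /nbhs_nr[e e0 H]; have e2 : 0 < e / 2 by rewrite divr_gt0.
have cc : {for z, continuous (fun z : R * R => z.1 * cos z.2)}.
  apply: cvgM; first exact: cvg_fst.
  by apply: (continuous_comp (f := snd)); [exact: cvg_snd|exact: continuous_cos].
have cs : {for z, continuous (fun z : R * R => z.1 * sin z.2)}.
  apply: cvgM; first exact: cvg_fst.
  by apply: (continuous_comp (f := snd)); [exact: cvg_snd|exact: continuous_sin].
have /cvgrPdist_lt/(_ _ e2) hc := cc.
have /cvgrPdist_lt/(_ _ e2) hs := cs.
apply: filterS2 hc hs => w hc hs; apply: H; rewrite !polarE.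
apply: le_lt_trans (nr_complex_le _ _) _.
by rewrite -[X in X + _]normrN -[X in _ + X]normrN !opprB; lra.
Qed.

Lemma polarP (w : R[i]) : exists2 t, 0 <= t <= 2 * pi & w = polar (nr w, t).
Proof.
have [/eqP w0|w0] := boolP (w == 0).
  by exists 0; rewrite ?lexx ?mulr_ge0 ?pi_ge0// w0 nr0 /polar/= mul0r.
have pi0 := pi_gt0 R.
have nw : 0 < nr w by rewrite -ltcR -nrE normr_gt0.
case: w w0 nw => x y _ nw; set w := (x +i* y)%C in nw *.
have nE : nr w ^+ 2 = x ^+ 2 + y ^+ 2.
  by rewrite /nr normc_def/= sqr_sqrtr// addr_ge0 ?sqr_ge0.
pose c := x / nr w; pose s := y / nr w.
have cs1 : c ^+ 2 + s ^+ 2 = 1.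
  by rewrite !expr_div_n -mulrDl -nE mulfV// expf_neq0// gt_eqF.
have c1 : -1 <= c <= 1.
  rewrite -ler_norml -(@ler_pXn2r _ 2) ?nnegrE// real_normK ?num_real//.
  by rewrite expr1n -cs1 lerDl sqr_ge0.
have s2 : 1 - c ^+ 2 = s ^+ 2 by rewrite -cs1 addrC addKr.
have key t : cos t = c -> sin t = s -> w = polar (nr w, t).
  move=> ct st; rewrite polarE/= ct st /c /s.
  by rewrite ![nr w * _]mulrC !divfK// gt_eqF.
have cosA : cos (acos c) = c by rewrite acosK// in_itv.
have := acos_ge0 c1; have := acos_lepi c1; have := sin_acos c1.
rewrite s2 sqrtr_sqr => sA A1 A0.
have [s0|s0] := leP 0 s.
  exists (acos c); first by apply/andP; split=> //; lra.
  by apply: key => //; rewrite sA ger0_norm.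
exists (pi *+ 2 - acos c); first by rewrite mulr2n; apply/andP; split; lra.
apply: key; first by rewrite addrC cosD2pi cosN.
by rewrite addrC sinD2pi sinN sA ltr0_norm ?opprK.
Qed.

End Polar.

Section LocalToGlobal.
Context {R : realType} {n : nat}.
Local Notation V := 'rV[R[i]]_n.
Variables (U : set V) (g : V -> R).
Hypothesis cg : forall x, U x -> {for x, continuous g}.
Hypothesis local_submean : forall x, U x ->
  exists2 rho : R, 0 < rho & forall b, nr b < rho -> g x <= mean g x b.

Let uniform_radius (rho : nat -> R) (B : R) N : 0 <= B -> (forall k, 0 < rho k) ->
  exists2 s : R, 0 < s & forall k, (k < N)%N -> s * B < rho k.
Proof.
move=> B0 r0; elim: N => [|N [s s0 H]]; first by exists 1.
have B1 : 0 < B + 1 by lra.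
exists (Num.min s (rho N / (B + 1))); first by rewrite lt_min s0 divr_gt0.
move=> k; rewrite ltnS leq_eqVlt => /predU1P[->|kN].
  apply: (@le_lt_trans _ _ (rho N / (B + 1) * B)).
    by rewrite ler_wpM2r// ge_min lexx orbT.
  by rewrite mulrAC ltr_pdivrMr// ltr_pM2l//; lra.
by apply: le_lt_trans (H k kN); rewrite ler_wpM2r// ge_min lexx.
Qed.

(** Averaging over a finite group of rotations of the disc gives a function
    that still satisfies the sub-mean value inequality at small radii; by the
    maximum principle some point of the unit circle has the largest value, so
    the value at the centre is at most an average of [g] over the vertices of
    an inscribed regular polygon. *)
Let polygon_bound p b N : disc_in U p b ->
  exists2 th, 0 <= th <= 2 * pi & g p * N.+1%:R <=
    \sum_(k < N.+1) g (circle p b (th + k%:R * (2 * pi / N.+1%:R))).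
Proof.
move=> d; set h := 2 * pi / _.
have p0 : 0 < 2 * pi :> R by rewrite mulr_gt0 ?pi_gt0.
pose Q : set (R * R) := `[0, 1]%classic `*` `[0, 2 * pi]%classic.
pose Phi z := \sum_(k < N.+1) g (p + polar (z.1, z.2 + k%:R * h) *: b).
have cptQ : compact Q by apply: compact_setX; exact: segment_compact.
have Q0 : Q (0, 0) by split; rewrite /= in_itv/= lexx ?ler01 ?ltW.
have cPhi : {within Q, continuous Phi}.
  apply: (@within_cont_sum _ _ _ N.+1 (fun k z => g (p + polar (z.1, z.2 + k%:R * h) *: b))).
  move=> k; apply/subspace_continuousP => z Qz; apply: cvg_within_filter.
  have cpol : {for z, continuous (fun z : R * R => p + polar (z.1, z.2 + k%:R * h) *: b)}.
    apply: (@continuous_comp _ _ _ (fun z : R * R => polar (z.1, z.2 + k%:R * h))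
       (fun w => p + w *: b)); last exact: line_continuous.
    apply: (@continuous_comp _ _ _ (fun z : R * R => (z.1, z.2 + k%:R * h)) polar).
      apply: (@cvg_pair _ _ _ (nbhs z) (nbhs z.1) (nbhs (z.2 + k%:R * h)) _ _ _
        fst (fun z => z.2 + k%:R * h)).
        exact: cvg_fst.
      by apply: cvgD; [exact: cvg_snd|exact: cvg_cst].
    exact: polar_continuous.
  apply: (continuous_comp cpol); apply: cg; apply: d.
  by move: Qz => [/=]; rewrite in_itv/= => /andP[z0 z1] _; rewrite nr_polar.
have [z1 /set_mem Qz1 z1max] := compact_EVT_max (ex_intro _ _ Q0) cptQ cPhi.
set m := Phi z1 in z1max.
have Phim z : Q z -> Phi z <= m by move=> Qz; apply: z1max; exact: mem_set.
have clQ : closed Q by apply: compact_closed => //; exact: norm_hausdorff.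
pose S := [set z | Q z /\ m <= Phi z].
have cptS : compact S.
  by apply: (subclosed_compact _ cptQ); [exact: within_cont_closed_ge|move=> z []].
have [] := @compact_EVT_max _ R fst S (ex_intro _ z1 (conj Qz1 (lexx _))) cptS.
  by apply: continuous_subspaceT => z; exact: cvg_fst.
move=> [r0 th0] /set_mem[[/=]]; rewrite !in_itv/= => /andP[r00 r01] th02 mPhi rmax.
have circ z t : Q z -> nr (polar z + t) <= 1 ->
    \sum_(k < N.+1) g (p + ((polar z + t) * cis (k%:R * h)) *: b) <= m.
  move=> Qz nt; have [th' h2 ->] := polarP (polar z + t).
  have := Phim (nr (polar z + t), th') _; rewrite /Phi /=.
  under eq_bigr do rewrite polar_cis.
  by apply; split; rewrite /= in_itv/= ?nr_ge0.
have r0E : r0 = 1.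
  apply/eqP; rewrite eq_le r01/= leNgt; apply/negP => r0lt.
  pose x k := p + polar (r0, th0 + k%:R * h) *: b.
  have Ux k : U (x k) by apply: d; rewrite nr_polar.
  have /choice[rho rhoP] k : exists rho : R, 0 < rho /\
      forall b', nr b' < rho -> g (x k) <= mean g (x k) b'.
    by have [rho ? ?] := local_submean (Ux k); exists rho.
  have [s0 s00 Hs0] := uniform_radius N.+1 (nr_ge0 b) (fun k => (rhoP k).1).
  pose s := Num.min s0 (1 - r0).
  have s_gt0 : 0 < s by rewrite lt_min s00 subr_gt0.
  have s1 : r0 + s <= 1 by rewrite -lerBrDl ge_min lexx orbT.
  pose bb k := (s%:C%C * cis (k%:R * h)) *: b.
  have circE k t : circle (x k) (bb k) t =
      p + ((polar (r0, th0) + s%:C%C * cis t) * cis (k%:R * h)) *: b.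
    rewrite /circle /x /bb polar_cis scalerA -addrA -scalerDl.
    by congr (_ + _ *: _); ring.
  have nw t : nr (polar (r0, th0) + s%:C%C * cis t) <= 1.
    apply: le_trans (nrD _ _) _.
    by rewrite nr_polar//= nrM nr_cis mulr1 (nr_real (ltW s_gt0)).
  have cc k : circ_continuous g (x k) (bb k).
    move=> t; apply: continuous_comp; first exact: circle_continuous.
    by apply: cg; rewrite circE; apply: d; rewrite nrM nr_cis mulr1.
  pose psi t := \sum_(k < N.+1) g (circle (x k) (bb k) t).
  have psim t : psi t <= m.
    rewrite /psi; under eq_bigr do rewrite circE.
    by apply: circ => //; split; rewrite /= in_itv/= ?r00.
  have cpsi : continuous psi.
    rewrite /psi; elim: (N.+1) => [|M IH].
      rewrite (_ : (fun t => _) = fun=> 0); first by move=> t; exact: cvg_cst.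
      by apply/funext => t; rewrite big_ord0.
    rewrite (_ : (fun t => _) = fun t => \sum_(k < M) g (circle (x k) (bb k) t) +
      g (circle (x M) (bb M) t)); last by apply/funext => t; rewrite big_ord_recr.
    by move=> t; apply: cvgD; [exact: IH|exact: cc].
  have mpsi : m <= (2 * pi)^-1 * \int[lebesgue_measure]_(t in `[0, 2 * pi]) psi t.
    rewrite (@int_sum _ (fun k t => g (circle (x k) (bb k) t)))//.
    rewrite mulr_sumr; apply: le_trans mPhi _; rewrite /Phi/=.
    apply: ler_sum => k _; apply: (rhoP k).2.
    rewrite nrZ nrM nr_cis mulr1 (nr_real (ltW s_gt0)).
    by apply: le_lt_trans (Hs0 k (ltn_ord k)); rewrite ler_wpM2r ?nr_ge0// ge_min lexx.
  have := mean_eq_max cpsi psim mpsi th02.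
  rewrite /psi; under eq_bigr do rewrite circE -polarDr -polar_cis.
  move=> Em; have : S (r0 + s, th0).
    split; last by rewrite /Phi/= Em.
    by split; rewrite /= in_itv/= ?s1 ?(addr_ge0 r00 (ltW s_gt0)).
  by move=> /mem_set/rmax/=; lra.
exists th0; first exact: th02.
rewrite r0E in mPhi.
have -> : \sum_(k < N.+1) g (circle p b (th0 + k%:R * h)) = Phi (1, th0).
  by apply: eq_bigr => k _; rewrite /circle /polar/= mul1r.
apply: le_trans mPhi; have := Phim _ Q0; rewrite /Phi /=.
under eq_bigr do rewrite /polar/= mul0r scale0r addr0.
by rewrite sumr_const card_ord mulr_natr.
Qed.

(** The polygon averages of [polygon_bound] approximate the mean over the
    circle, so that no harmonic majorant is needed to pass from small discs to
    all discs. *)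
Lemma submean_local : submean U g.
Proof.
move=> p b d; apply: (@mean_ge_polygons _ (g \o circle p b)).
- exact: circle_comp_continuous cg d.
- by move=> t; rewrite /= /circle /cis cosD2pi sinD2pi.
- by move=> N; exact: polygon_bound.
Qed.

End LocalToGlobal.

(** * Sup-convolutions *)

Section SupConvolution.
Context {R : realType} {n : nat}.
Local Notation V := 'rV[R[i]]_n.
Variables (X : set V) (u : V -> \bar R).
Hypothesis cptX : compact X.
Hypothesis X0 : X !=set0.
Hypothesis uX : usc_on X u.

Lemma usc_compact_bounded : exists2 M : R, 0 <= M & forall x, X x -> (u x <= M%:E)%E.
Proof.
suff [N HN] : exists N, forall k, (N <= k)%N -> forall x, X x -> X x ->
    (u x <= k%:R%:E)%E.
  by exists N%:R => // x Xx; exact: (HN N (leqnn _) x Xx Xx).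
apply: compact_eventually => // x Xx; have [uoo uu] := uX Xx.
have [a ua] : exists a : R, (u x < a%:E)%E.
  move: uoo; case: (u x) => [r| |]// _; last by exists 0; exact: ltNyr.
  by exists (r + 1); rewrite lte_fin ltrDl.
have := uu a ua; rewrite near_withinE => na.
exists (Num.truncn a).+1; apply: filterS na => y h k Nk Xy.
apply: le_trans (ltW (h Xy)) _; rewrite lee_fin; apply: (le_trans (ltW (truncnS_gt a))).
by rewrite ler_nat.
Qed.

Let M := sval (cid2 usc_compact_bounded).

Let M0 : 0 <= M.
Proof. by rewrite /M; case: cid2. Qed.

Let uM x : X x -> (u x <= M%:E)%E.
Proof. by rewrite /M; case: cid2 => N ? H; exact: H. Qed.

Let tr k x : R := fine (Order.max (u x) (- k%:R)%:E).

Let trE k x : X x -> (tr k x)%:E = Order.max (u x) (- k%:R)%:E.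
Proof.
move=> Xx; rewrite /tr fineK// fin_numE -ltey -ltNye.
have [uoo _] := uX Xx.
by rewrite lt_max ltNyr orbT gt_max uoo ltry.
Qed.

Let tr_ge k x : X x -> (u x <= (tr k x)%:E)%E.
Proof. by move=> /trE ->; rewrite le_max lexx. Qed.

Let tr_geN k x : X x -> - k%:R <= tr k x.
Proof. by move=> Xx; rewrite -lee_fin trE// le_max lexx orbT. Qed.

Let tr_leM k x : X x -> tr k x <= M.
Proof.
move=> Xx; rewrite -lee_fin trE// ge_max uM//= lee_fin.
by rewrite (le_trans _ M0)// oppr_le0.
Qed.

Let slope k : R := k.+1%:R ^+ 2.

Let slope_gt0 k : 0 < slope k.
Proof. by rewrite exprn_gt0. Qed.

(** Sup-convolutions of the truncations [max (u, - k)]: these are suprema of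
    translates of [u] minus constants, hence sub-mean away from the boundary,
    and Lipschitz.  The slope grows faster than the size of the truncation, so
    that only translations by vectors tending to 0 contribute. *)
Definition supconv k (z : V) : R :=
  sup [set tr k w - slope k * nr (z - w) | w in X].

Let supconv_le k z a : (forall w, X w -> tr k w - slope k * nr (z - w) <= a) ->
  supconv k z <= a.
Proof.
move=> H; apply: ge_sup => [|_ [w Xw <-]]; last exact: H.
by have [w Xw] := X0; exists (tr k w - slope k * nr (z - w)), w.
Qed.

Let supconv_ub k z w : X w -> tr k w - slope k * nr (z - w) <= supconv k z.
Proof.
move=> Xw; apply: ub_le_sup; last by exists w.
exists M => _ [y Xy <-]; rewrite lerBlDr.
by rewrite (le_trans (tr_leM k Xy))// lerDl mulr_ge0 ?nr_ge0// ltW.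
Qed.

Lemma supconv_continuous k : continuous (supconv k).
Proof.
apply: (lip_continuous (slope_gt0 k)) => x y; apply: supconv_le => w Xw.
have := supconv_ub k y Xw; have := nr_dist y x w; rewrite (nrC y x).
by move=> /(ler_wpM2l (ltW (slope_gt0 k))); rewrite mulrDr; lra.
Qed.

Lemma supconv_ge k x : X x -> (u x <= (supconv k x)%:E)%E.
Proof.
move=> Xx; apply: le_trans (tr_ge k Xx) _; rewrite lee_fin.
by have := supconv_ub k x Xx; rewrite subrr nr0 mulr0 subr0.
Qed.

Lemma supconv_geN k x : X x -> - k%:R <= supconv k x.
Proof.
move=> Xx; apply: le_trans (tr_geN k Xx) _.
by have := supconv_ub k x Xx; rewrite subrr nr0 mulr0 subr0.
Qed.

Lemma supconv_anti z : {homo supconv^~ z : k l / (k <= l)%N >-> l <= k}.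
Proof.
move=> k l kl; apply: supconv_le => w Xw; apply: le_trans (supconv_ub k z Xw).
apply: lerB.
  rewrite -lee_fin !trE// ge_max !le_max lexx/= lee_fin lerN2 ler_nat.
  by rewrite kl orbT.
rewrite ler_wpM2r ?nr_ge0// /slope ler_pXn2r ?nnegrE ?ler0n// ler_nat ltnS//.
Qed.

(** Upper semicontinuity makes the competitors near [x] smaller than [a]; the
    slope excludes the others. *)
Lemma supconv_lt x (a : R) : X x -> (u x < a%:E)%E ->
  exists N, \forall y \near x, forall k, (N <= k)%N -> supconv k y < a.
Proof.
move=> Xx uxa; have [_ uu] := uX Xx.
have [a' ua' a'a] : exists2 a' : R, (u x < a'%:E)%E & a' < a.
  case: (u x) uxa => [r| |]//.
    by rewrite lte_fin => ra; exists ((r + a) / 2); rewrite ?lte_fin; lra.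
  by move=> _; exists (a - 1); [exact: ltNyr|lra].
have := uu a' ua'; rewrite near_withinE => /nbhs_nr[e e0 He].
have e2 : 0 < e / 2 by rewrite divr_gt0.
have [N NP] : exists N : nat, Num.max (- a') ((M - a') / (e / 2)) <= N%:R.
  by exists (Num.truncn (Num.max (- a') ((M - a') / (e / 2)))).+1; exact/ltW/truncnS_gt.
exists N; apply: filterS (near_nr x e2) => y yx k Nk.
have {}NP : Num.max (- a') ((M - a') / (e / 2)) <= k%:R.
  by apply: le_trans NP _; rewrite ler_nat.
move: NP; rewrite ge_max => /andP[h1 h2].
apply: le_lt_trans a'a; apply: supconv_le => w Xw.
have sk : k%:R <= slope k.
  rewrite /slope -(natr1 k) sqrrD expr1n mulr1; have : 0 <= k%:R :> R by [].
  by have := sqr_ge0 (k%:R : R); lra.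
have [we|we] := ltP (nr (w - x)) e.
  rewrite lerBlDr -[leLHS]addr0 lerD ?mulr_ge0 ?nr_ge0 ?(ltW (slope_gt0 k))//.
  by rewrite -lee_fin trE// ge_max (ltW (He w we Xw)) lee_fin; lra.
have yw : e / 2 <= nr (y - w).
  by have := nr_dist w y x; rewrite (nrC w y); lra.
have : (M - a') <= slope k * nr (y - w).
  rewrite ler_pdivrMr// in h2; apply: le_trans h2 _.
  by apply: ler_pM => //; exact: ltW.
by have := tr_leM k Xw; lra.
Qed.

Let supconv_radius k : R := (M + k%:R) / k.+1%:R ^+ 2.

Let supconv_radius_lt (e : R) : 0 < e ->
  exists N, forall k, (N <= k)%N -> supconv_radius k < e.
Proof.
move=> e0; exists (Num.truncn ((M + 1) / e)).+1 => k Nk.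
rewrite /supconv_radius ltr_pdivrMr ?exprn_gt0//.
have : (M + 1) / e < k%:R.
  by apply: lt_le_trans (truncnS_gt _) _; rewrite ler_nat.
rewrite ltr_pdivrMr// -(natr1 k) => h.
have k0 : 0 <= k%:R :> R by [].
have : M * 1 <= M * (k%:R + 1) by rewrite ler_wpM2l// lerDr.
have : (M + 1) * (k%:R + 1) < (k%:R * e) * (k%:R + 1) by rewrite ltr_pM2r//; lra.
have : 0 <= e * (k%:R + 1) by rewrite mulr_ge0 ?ltW//; lra.
by rewrite expr2; lra.
Qed.

(** Each competitor [w] in the supremum defining [supconv k p] is handled by the
    disc of [u] centred at [w], a translate of the given one; a competitor
    farther away than [supconv_radius k] contributes less than the lower bound
    [- k] of [supconv k]. *)
Let supconv_submean_radius (Omega : set V) k p b : open Omega -> Omega `<=` X ->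
  psh Omega u ->
  disc_in [set x | forall y, nr (y - x) <= supconv_radius k -> Omega y] p b ->
  supconv k p <= mean (supconv k) p b.
Proof.
move=> oO OX pu d.
have rad0 : 0 <= supconv_radius k by rewrite divr_ge0 ?addr_ge0 ?sqr_ge0.
have dO : disc_in Omega p b by move=> w /d; apply; rewrite subrr nr0.
have ccirc w : circ_continuous (supconv k) w b.
  move=> t; apply: continuous_comp; first exact: circle_continuous.
  exact: supconv_continuous.
have meanN : - k%:R <= mean (supconv k) p b.
  rewrite -[leLHS](mean_cst (- k%:R) p b); apply: mean_le => //.
    by move=> t; exact: cvg_cst.
  by move=> t; apply: supconv_geN; apply: OX; exact: circle_in.
apply: supconv_le => w Xw.
have [wp|wp] := leP (nr (w - p)) (supconv_radius k); last first.
  apply: le_trans meanN; have := tr_leM k Xw.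
  move: wp; rewrite /supconv_radius ltr_pdivrMr ?exprn_gt0// mulrC nrC -/(slope k).
  by lra.
set c := slope k * nr (p - w).
have c0 : 0 <= c by rewrite mulr_ge0 ?nr_ge0// ltW.
rewrite lerBlDr -lee_fin trE// ge_max lee_fin; apply/andP; split; last lra.
have dw : disc_in Omega w b.
  move=> z z1; apply: (d z z1); rewrite opprD addrACA subrr addr0 //.
apply: le_trans (psh_submean pu dw) _.
have cm : circ_continuous (fun x => supconv k x + c) p b.
  by move=> t; apply: cvgD; [exact: ccirc|exact: cvg_cst].
rewrite -[X in _ + X](mean_cst c p b) -meanD//; last by move=> t; exact: cvg_cst.
rewrite -mean_ereal//; apply: lee_wpmul2l.
  by rewrite lee_fin invr_ge0 mulr_ge0// pi_ge0.
apply: le_integral_measurable => //.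
- apply: measurable_funTS.
  rewrite (_ : (fun t => _) = \- (\- (fun t => u (circle w b t))))%E.
    apply: measurableT_comp => //; apply: lower_semicontinuous_measurable.
    move=> t a; rewrite lteNr -EFinN => uta.
    have [uO _] := pu; have Oc := circle_in t dw.
    have [_ /(_ _ uta)] := uO _ Oc; rewrite near_withinE => nu.
    have nU : \forall y \near circle w b t, (u y < (- a)%:E)%E.
      have nO : \forall y \near circle w b t, Omega y by apply: open_nbhs_nbhs.
      by apply: filterS2 nO nu => y Oy; exact.
    exists [set s | (u (circle w b s) < (- a)%:E)%E].
      exact: (@circle_continuous R n w b t _ nU).
    by move=> s /=; rewrite lteNr EFinN.
  by apply/funext => t; rewrite oppeK.
- apply/measurable_EFinP; apply: measurable_funTS.
  by apply: continuous_measurable_fun; exact: cm.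
move=> t _; have Xc : X (circle w b t) by apply: OX; exact: circle_in.
apply: le_trans (tr_ge k Xc) _; rewrite lee_fin -lerBlDr.
have := supconv_ub k (circle p b t) Xc.
by rewrite /c /circle opprD addrACA subrr addr0.
Qed.

Lemma supconv_submean (Omega : set V) (eta : R) : open Omega -> Omega `<=` X ->
  psh Omega u -> 0 < eta -> exists N, forall k, (N <= k)%N -> forall p b,
    disc_in [set x | forall y, nr (y - x) < eta -> Omega y] p b ->
    supconv k p <= mean (supconv k) p b.
Proof.
move=> oO OX pu eta0; have [N HN] := supconv_radius_lt eta0.
exists N => k Nk p b d; apply: (supconv_submean_radius oO OX pu) => w w1 y yw.
exact: d w w1 y (le_lt_trans yw (HN k Nk)).
Qed.

End SupConvolution.

(** * Jensen measures and Edwards' theorem *)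

Section Cozero.
Context {R : realType} {V : normedModType R[i]}.

(** The distance to the complement shows that an open set is a cozero set. *)
Lemma open_cozero (U : set V) : open U -> exists2 d : V -> R,
  continuous d & forall x, 0 <= d x /\ (U x <-> 0 < d x).
Proof.
move=> oU; have [[w0 Cw0]|C0] := pselect ((~` U) !=set0); last first.
  exists (fun=> 1); first exact: cst_continuous.
  by move=> x; split=> //; split=> // _; apply: contrapT => nU; apply: C0; exists x.
pose D x := [set nr (x - w) | w in ~` U].
pose d x := inf (D x).
have d_le x w : (~` U) w -> d x <= nr (x - w).
  move=> Cw; apply: ge_inf; last by exists w.
  by exists 0 => _ [y _ <-]; exact: nr_ge0.
have d_ge a x : (forall w, (~` U) w -> a <= nr (x - w)) -> a <= d x.
  move=> H; apply: lb_le_inf; first by exists (nr (x - w0)), w0.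
  by move=> _ [w Cw <-]; exact: H.
exists d.
  apply: (lip_continuous ltr01) => x y; rewrite mul1r -lerBlDr.
  apply: (d_ge _ _) => w Cw; rewrite lerBlDr addrC.
  exact: le_trans (d_le x w Cw) (nr_dist x y w).
move=> x; split; first by apply: (d_ge _ _) => w _; exact: nr_ge0.
split=> [Ux|dx]; last first.
  by apply: contrapT => nU; have := d_le x x nU; rewrite subrr nr0; lra.
have : nbhs x U by apply: open_nbhs_nbhs.
move=> /nbhs_nr[e e0 He]; apply: (lt_le_trans e0); apply: (d_ge _ _) => w Cw.
by rewrite leNgt; apply/negP => h; apply: Cw; apply: He; rewrite nrC.
Qed.

End Cozero.

Section Edwards.
Context {R : realType} {n : nat}.
Local Notation V := 'rV[R[i]]_n.
Variable X : set V.
Hypothesis cptX : compact X.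
Hypothesis closedX : closed X.

Let minorants (h : V -> R) : set (V -> R) :=
  [set g | PSHo X g /\ forall x, X x -> g x <= h x].

Section AtPoint.
Variable z : V.
Hypothesis Xz : X z.

Let env (h : V -> R) : R := sup [set g z | g in minorants h].

Let env_ge h g : minorants h g -> g z <= env h.
Proof.
move=> gh; apply: ub_le_sup; last by exists g.
by exists (h z) => _ [g' [_ H] <-]; exact: H.
Qed.

Let env_le h a : {within X, continuous h} -> (forall g, minorants h g -> g z <= a) ->
  env h <= a.
Proof.
move=> ch H; apply: ge_sup => [|_ [g gh <-]]; last exact: H.
have [B B0 hB] := within_cont_bounded cptX ch.
exists (- B), (fun=> - B) => //; split; first exact: PSHo_cst.
by move=> x /hB; rewrite ler_norml => /andP[].
Qed.

(** Since [PSHo X] is a convex cone, the functional [f |-> - env (- f)] is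
    sublinear.  Let [L] be a linear functional below it that agrees with it at
    [- h].  As [PSHo X] contains the constants, [L] is positive and normalized;
    and [u z <= L u] for [u] in [PSHo X], so the measure representing [L] is a
    Jensen measure. *)
Lemma exists_Jensen h : {within X, continuous h} ->
  exists2 mu : probability (borel V) R, Jensen X z mu &
    (\int[mu]_(x in X) (h x)%:E = (env h)%:E)%E.
Proof.
move=> ch.
pose S : set (V -> R^o) := [set f : V -> R | {within X, continuous f}].
pose p (f : V -> R^o) : R := - env (fun x => - f x).
have SN (f : V -> R) : {within X, continuous f} ->
    {within X, continuous (fun x => - f x)}.
  by move=> cf; have := @within_contZ _ _ _ (-1) _ cf; under eq_fun do rewrite mulN1r.
have ps : sublinear_on S p.
  split=> [f g Sf Sg|c f c0 Sf]; rewrite /p; last first.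
    rewrite mulrN lerN2 mulrC -ler_pdivlMr//; apply: env_le; first exact: SN.
    move=> g [pg gf]; rewrite ler_pdivlMr// mulrC.
    apply: (@env_ge _ (fun x => c * g x)); split; first exact: PSHoZ (ltW c0) pg.
    by move=> x Xx; rewrite -[leRHS]mulrN ler_pM2l//; exact: gf.
  rewrite -opprD lerN2 -lerBrDr; apply: env_le; first exact: SN.
  move=> g1 [pg1 gf1]; rewrite lerBrDr addrC -lerBrDr.
  apply: env_le; first exact: SN.
  move=> g2 [pg2 gf2]; rewrite lerBrDr.
  apply: (@env_ge _ (fun x => g2 x + g1 x)); split; first exact: PSHoD.
  by move=> x Xx; rewrite opprD addrC lerD ?gf1 ?gf2.
have SD f g : S f -> S g -> S (f + g) by move=> Sf Sg; exact: within_contD.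
have SZ c f : S f -> S (c *: f) by move=> Sf; exact: within_contZ.
have [L [LD LZ Lp Lh]] := hahn_banach SD SZ ps (SN _ ch : S (fun x => - h x)).
have LN f : S f -> L (fun x => - f x) = - L f.
  move=> Sf; rewrite -mulN1r -LZ//; congr L; apply/funext => x.
  by rewrite -[RHS]/(-1 * f x) mulN1r.
have L_le f g : S f -> S g -> (forall x, X x -> f x <= g x) -> L f <= L g.
  move=> Sf Sg fg; rewrite -subr_le0 -(LN _ Sg) -LD//; last exact: SN.
  apply: le_trans (Lp _ _) _; first by apply: SD => //; exact: SN.
  rewrite /p oppr_le0; apply: (@env_ge _ (fun=> 0)); split; first exact: PSHo_cst.
  by move=> x /fg; rewrite !fctE; lra.
have L1 : L (fun=> 1) = 1.
  have S1 : S (fun=> 1) by exact: within_cont_cst.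
  apply/eqP; rewrite eq_le; apply/andP; split.
    apply: le_trans (Lp _ S1) _; rewrite /p lerNl.
    by apply: (@env_ge _ (fun=> -1)); split => //; exact: PSHo_cst.
  rewrite -lerN2 -(LN _ S1); apply: le_trans (Lp _ (SN _ S1)) _.
  rewrite /p lerN2; apply: (@env_ge _ (fun=> 1)); split; first exact: PSHo_cst.
  by move=> x _; rewrite opprK.
have [mu [rmu muX muL]] := @riesz_representation R V X cptX closedX
  (@open_cozero R V) L LD LZ L_le L1.
exists mu; last first.
  rewrite muL//; congr EFin; apply: oppr_inj; rewrite -LN// Lh /p.
  by under eq_fun do rewrite opprK.
split => // u pu; have cu := PSHo_cont pu; rewrite muL// lee_fin -lerN2 -LN//.
apply: le_trans (Lp _ (SN _ cu)) _; rewrite /p lerN2.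
by apply: env_ge; split => // x _; rewrite opprK.
Qed.

(** Edwards' theorem: a function of [PSH X] lies below the integrals of [h]
    against all Jensen measures, and by [exists_Jensen] one of these integrals
    is the envelope. *)
Lemma edwards_at (w : V -> \bar R) h (e : R) : PSH X w -> {within X, continuous h} ->
  (forall x, X x -> (w x <= (h x)%:E)%E) -> 0 < e ->
  exists2 g, minorants h g & (w z < (g z + e)%:E)%E.
Proof.
move=> [uw Jw] ch wh e0; have [mu Jmu muh] := exists_Jensen ch.
have mX : measurable (X : set (borel V)) by exact: closed_borel.
have wE : (w z <= (env h)%:E)%E.
  apply: le_trans (Jw z mu Xz Jmu) _; rewrite -muh.
  apply: le_integral_measurable => //; first exact: usc_measurable.
  by apply/measurable_EFinP; exact: within_cont_measurable.
apply: contrapT => H; suff : env h <= env h - e by lra.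
apply: env_le => // g gh; rewrite lerBrDr -lee_fin; apply: le_trans wE.
by rewrite leNgt; apply/negP => wg; apply: H; exists g.
Qed.

End AtPoint.

(** Minorants are directed under pointwise maxima, so compactness upgrades the
    pointwise approximation to a uniform one. *)
Lemma PSH_approx (w : V -> \bar R) h (e : R) : PSH X w -> {within X, continuous h} ->
  (forall x, X x -> (w x <= (h x)%:E)%E) -> 0 < e ->
  exists g, PSHo X g /\ forall x, X x -> g x <= h x /\ (w x < (g x + e)%:E)%E.
Proof.
move=> pw ch wh e0.
pose B (g : V -> R) := [set g' : V -> R | forall x, X x -> g x <= g' x].
pose F := filter_from (minorants h) B.
have FF : Filter F.
  apply: filter_from_filter.
    have [M M0 hM] := within_cont_bounded cptX ch.
    exists (fun=> - M); split; first exact: PSHo_cst.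
    by move=> x /hM; rewrite ler_norml => /andP[].
  move=> g1 g2 [p1 h1] [p2 h2]; exists (fun x => Num.max (g1 x) (g2 x)).
    by split; [exact: PSHo_max|move=> x Xx; rewrite ge_max h1 ?h2].
  by move=> g H; split=> x /H; rewrite ge_max => /andP[].
suff : \forall g \near F, forall x, X x -> X x -> (w x < (g x + e)%:E)%E.
  move=> [g [pg gh] Hg]; exists g; split => // x Xx; split; first exact: gh.
  exact: (Hg g (fun _ _ => lexx _) x Xx Xx).
apply: (compact_near_coveringP X).1 => // x Xx.
have [g0 g0h] := edwards_at Xx pw ch wh e0.
have [_ uw] := pw.1 x Xx.
move=> wg; have [a wa ag] : exists2 a : R, (w x < a%:E)%E & a < g0 x + e.
  case: (w x) wg => [r| |]//.
    by rewrite lte_fin => rg; exists ((r + (g0 x + e)) / 2); rewrite ?lte_fin; lra.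
  by move=> _; exists (g0 x + e - 1); [exact: ltNyr|lra].
have := uw a wa; rewrite near_withinE => n1.
have n2 : \forall y \near x, X y -> a - e < g0 y.
  by apply: (within_cont_gt (PSHo_cont g0h.1) Xx); lra.
exists ([set y | X y -> (w y < (g0 y + e)%:E)%E], B g0).
  split; last by exists g0.
  apply: filterS2 n1 n2 => y h1 h2 Xy; apply: lt_trans (h1 Xy) _.
  by rewrite lte_fin; have := h2 Xy; lra.
move=> [y g] /= [h1 h2] Xy; apply: lt_le_trans (h1 Xy) _.
by rewrite lee_fin lerD2r; exact: h2.
Qed.

End Edwards.

(** * The maximum principle *)

Section CompactClosure.
Context {R : realType} {n : nat}.
Local Notation V := 'rV[R[i]]_n.

Lemma closed_disc_compact (r : R) : compact [set c : R[i] | nr c <= r].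
Proof.
rewrite (_ : mkset _ = polar @` (`[0, r]%classic `*` `[0, 2 * pi]%classic)).
  apply: continuous_compact; first by apply: continuous_subspaceT; exact: polar_continuous.
  by apply: compact_setX; exact: segment_compact.
apply/seteqP; split=> [c /= cr|c [[s t] [/=]]].
  have [t t2 ->] := polarP c; exists (nr c, t) => //.
  by split; rewrite /= in_itv/= ?nr_ge0.
by rewrite !in_itv/= => /andP[s0 sr] _ <-; rewrite nr_polar.
Qed.

Lemma nr_coord (v : V) i : nr (v ord0 i) <= nr v.
Proof.
rewrite -lecR -!nrE [leRHS]/Num.norm/= mx_normE.
rewrite [_ <= _%:num]num_le; apply/bigmax_geP; right; exists (ord0, i); rewrite //.
exact: lexx.
Qed.

Lemma bounded_closure_compact (A : set V) : bounded_set A -> compact (closure A).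
Proof.
move=> [[M M'] []]; rewrite complex_real => /eqP -> HM.
have [K HK] : exists K : R, forall v, A v -> nr v <= K.
  exists (M + 1) => v Av; rewrite -lecR -nrE; apply: (HM (M + 1)%:C%C) => //.
  by rewrite ltcE/= eqxx/= ltrDl ltr01.
pose box := [set v : V | forall i, [set c : R[i] | nr c <= K] (v ord0 i)].
have cbox : compact box.
  apply: (@rV_compact R[i] n (fun=> [set c : R[i] | nr c <= K])) => i.
  exact: closed_disc_compact.
have clbox : closed box by apply: compact_closed => //; exact: norm_hausdorff.
apply: (subclosed_compact _ cbox); first exact: closed_closure.
rewrite [X in _ `<=` X]((closure_id box).1 clbox).
apply: closure_subset => v Av i /=.
exact: le_trans (nr_coord v i) (HK v Av).
Qed.

End CompactClosure.

Section MaximumPrinciple.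
Context {R : realType} {n : nat}.
Local Notation V := 'rV[R[i]]_n.
Variables (Omega : set V) (phi : V -> R).
Hypothesis openO : open Omega.
Hypothesis connO : connected Omega.
Local Notation X := (closure Omega).
Hypothesis cptX : compact X.
Hypothesis phiPSH : PSH X (EFin \o phi).
Hypothesis phi_cont : {within X, continuous phi}.

Let closedX : closed X.
Proof. exact: closed_closure. Qed.

Let OX : Omega `<=` X.
Proof. exact: subset_closure. Qed.

Lemma closure_boundary (x : V) : X x -> Omega x \/ boundary Omega x.
Proof.
move=> Xx; have [|nO] := pselect (Omega x); first by left.
by right; split => //; rewrite /interior/= => /nbhs_singleton.
Qed.

Let phi_cont_at x : Omega x -> {for x, continuous phi}.
Proof.
apply: (within_cont_open phi openO).1.
exact: continuous_subspaceW phi_cont.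
Qed.

(** By [PSH_approx], [phi] is a uniform limit on [X] of functions that are
    plurisubharmonic near [X]. *)
Lemma PSH_submean : submean Omega phi.
Proof.
move=> p b d; apply/ler_addgt0Pr => e e0.
have [g [pg gphi]] := PSH_approx cptX closedX phiPSH phi_cont
  (fun x _ => lexx _) e0.
have /PSHoP[U [g' [XU [oU cg sg] gg]]] := pg.
have Xp : X p by exact/OX/(center_in d).
have dU : disc_in U p b by move=> w /d/OX/XU.
have := (gphi p Xp).2; rewrite /= lte_fin => /ltW/le_trans; apply.
rewrite lerD2r -gg//; apply: le_trans (sg p b dU) _; apply: mean_le.
- exact: circle_comp_continuous cg dU.
- exact: circle_comp_continuous phi_cont_at d.
move=> t; have Xc : X (circle p b t) by apply: OX; exact: circle_in.
by rewrite gg//; exact: (gphi _ Xc).1.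
Qed.

Hypothesis phi_nonconst : ~ (exists c : R, forall z, X z -> phi z = c).
Hypothesis phi_boundary : forall z, boundary Omega z -> phi z = 0.

(** If [phi] were nonnegative somewhere in [Omega] then it would attain its
    maximum there; the set of interior maximum points is open by the sub-mean
    inequality and closed in [Omega], so [phi] would be constant. *)
Lemma PSH_boundary0_lt0 x : Omega x -> phi x < 0.
Proof.
move=> Ox; rewrite ltNge; apply/negP => phix.
have [z0 /set_mem Xz0 z0max] := compact_EVT_max (ex_intro _ x (OX Ox)) cptX phi_cont.
have [x1 Ox1 x1max] : exists2 x1, Omega x1 & forall y, X y -> phi y <= phi x1.
  have [Oz|bz] := closure_boundary Xz0; first by exists z0 => // y /mem_set/z0max.
  exists x => // y /mem_set/z0max; rewrite (phi_boundary bz) => /le_trans; exact.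
set M := phi x1 in x1max.
have spread p b : disc_in Omega p b -> phi p = M -> phi (p + b) = M.
  move=> d pM; have := @mean_eq_max R (phi \o circle p b) M.
  move=> /(_ (circle_comp_continuous phi_cont_at d)) H.
  rewrite -[RHS](H _ _ 0) ?lexx ?mulr_ge0 ?pi_ge0//=.
  - by rewrite /circle cis0 scale1r.
  - by move=> t /=; apply: x1max; apply: OX; exact: circle_in.
  - by rewrite -pM; exact: PSH_submean.
apply: phi_nonconst; exists M.
have OM : Omega `&` [set y | phi y = M] = Omega.
  apply: connO.
  - by exists x1.
  - exists (Omega `&` [set y | phi y = M]); last by rewrite setIA setIid.
    rewrite openE => y [Oy yM]; have : nbhs y Omega by apply: open_nbhs_nbhs.
    move=> /nbhs_nr[e e0 He]; apply/nbhs_nr; exists e => // w we.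
    have dO : disc_in Omega y (w - y).
      move=> c c1; apply: He; rewrite addrC addKr nrZ.
      by apply: le_lt_trans we; rewrite ler_piMl// nr_ge0.
    split; first exact: He.
    by have := spread y (w - y) dO yM; rewrite addrC subrK.
  - exists [set y | X y /\ M <= phi y]; first exact: within_cont_closed_ge.
    apply/seteqP; split=> [y [Oy /= yM]|y [Oy [Xy yM]]].
      by split; [exact: Oy|split; [exact: OX|rewrite yM lexx]].
    by split; [exact: Oy|apply/eqP; rewrite eq_le yM andbT; exact: x1max].
move=> z Xz; apply/eqP; rewrite eq_le x1max//= leNgt; apply/negP => zM.
have [y [Oy yM]] := Xz _ (within_cont_lt phi_cont Xz zM).
have := yM (OX Oy); rewrite -OM in Oy; case: Oy => _ /= ->.
by rewrite ltxx.
Qed.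

End MaximumPrinciple.

(** * Gluing *)

Section Gluing.
Context {R : realType} {n : nat}.
Local Notation V := 'rV[R[i]]_n.
Implicit Types (Omega X K : set V) (f G : V -> R).

Lemma continuous_near_eq {T : topologicalType} (g h : T -> R) (x : T) :
  (\forall y \near x, g y = h y) ->
  {for x, continuous h} -> {for x, continuous g}.
Proof.
move=> gh ch; apply/cvgrPdist_lt => e e0.
have gx := nbhs_singleton gh.
have /cvgrPdist_lt/(_ e e0) := ch; apply: filterS2 gh => y.
by rewrite gx => ->.
Qed.

Definition glue Omega f G (x : V) : R :=
  if x \in Omega then Num.max (f x) (G x) else G x.

(** The glued function coincides with [G] off [K] and with the maximum of [f] and
    [G] on [Omega], an open set containing [K] with a margin; so it satisfies
    the sub-mean inequality on small discs. *)
Lemma PSHo_glue Omega X K f G (eta : R) : open Omega -> Omega `<=` X ->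
  closed K -> 0 < eta -> (forall x, K x -> forall y, nr (y - x) < eta -> Omega y) ->
  continuous f -> (forall x, K x -> forall b, nr b < eta -> f x <= mean f x b) ->
  PSHo X G -> (forall x, Omega x -> ~ K x -> f x <= G x) ->
  PSHo X (glue Omega f G).
Proof.
move=> oO OX clK eta0 KO cf sf /PSHoP[U [H [XU [oU cH sH] HG]]] fG.
pose W := glue Omega f H; apply/PSHoP; exists U, W.
have KOmega x : K x -> Omega x by move=> Kx; apply: (KO x Kx); rewrite subrr nr0.
have HW x : H x <= W x.
  by rewrite /W /glue; case: ifP => _ //; rewrite le_max lexx orbT.
have WK x : ~ K x -> W x = H x.
  move=> nK; rewrite /W /glue; case: ifPn => // /set_mem Ox.
  by rewrite max_r// HG ?fG//; exact: OX.
have WO x : Omega x -> W x = Num.max (f x) (H x).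
  by move=> Ox; rewrite /W /glue mem_set.
have cW x : U x -> {for x, continuous W}.
  move=> Ux; have [Kx|nK] := pselect (K x).
    apply: (@continuous_near_eq _ _ (fun y => Num.max (f y) (H y))).
      have : nbhs x Omega by apply: open_nbhs_nbhs; split => //; exact: KOmega.
      by apply: filterS => y /WO.
    exact: (continuous_max (cf x) (cH x Ux)).
  apply: (continuous_near_eq _ (cH x Ux)).
  have : nbhs x (~` K) by apply: open_nbhs_nbhs; split => //; exact: closed_openC.
  by apply: filterS => y /WK.
split => //; last by move=> x Xx; rewrite /W /glue HG.
split => //; apply: submean_local => // x Ux.
have : nbhs x U by apply: open_nbhs_nbhs.
move=> /nbhs_nr[e e0 He]; exists (Num.min e eta); first by rewrite lt_min e0.
move=> b; rewrite lt_min => /andP[be beta].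
have dU : disc_in U x b.
  move=> w w1; apply: He; rewrite addrC addKr nrZ.
  by apply: le_lt_trans be; rewrite ler_piMl// nr_ge0.
have ccW := circle_comp_continuous cW dU.
have HxW : H x <= mean W x b.
  apply: le_trans (sH x b dU) _; apply: mean_le => //.
  exact: circle_comp_continuous cH dU.
have [Kx|nK] := pselect (K x); last by rewrite WK.
rewrite WO ?ge_max ?HxW ?andbT; last exact: KOmega.
apply: le_trans (sf x Kx b beta) _; apply: mean_le => //.
  by move=> t; apply: continuous_comp; [exact: circle_continuous|exact: cf].
move=> t; rewrite WO ?le_max ?lexx//; apply: (KO x Kx).
by rewrite /circle addrC addKr nrZ nr_cis mul1r.
Qed.

End Gluing.

Section MainInequality.
Context {R : realType} {n : nat}.
Local Notation V := 'rV[R[i]]_n.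
Variables (Omega : set V) (u v : V -> \bar R) (phi : V -> R).
Local Notation X := (closure Omega).
Hypothesis openO : open Omega.
Hypothesis cptX : compact X.
Hypothesis pu : psh Omega u.
Hypothesis uX : usc_on X u.
Hypothesis pv : PSH X v.
Hypothesis uv : forall z, boundary Omega z -> u z = v z.
Hypothesis pphi : PSH X (EFin \o phi).
Hypothesis cphi : {within X, continuous phi}.
Hypothesis phi0 : forall z, boundary Omega z -> phi z = 0.

Let closedX : closed X.
Proof. exact: closed_closure. Qed.

Let OX : Omega `<=` X.
Proof. exact: subset_closure. Qed.

Lemma compact_margin (K : set V) : compact K -> K `<=` Omega ->
  exists2 eta : R, 0 < eta & forall x, K x -> forall y, nr (y - x) < eta -> Omega y.
Proof.
move=> cptK KO.
have [N HN] : exists N, forall k, (N <= k)%N -> forall x, K x ->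
    forall y, nr (y - x) < k.+1%:R^-1 -> Omega y.
  apply: compact_eventually => // x /KO Ox.
  have : nbhs x Omega by apply: open_nbhs_nbhs.
  move=> /nbhs_nr[e e0 He]; have e2 : 0 < e / 2 by rewrite divr_gt0.
  exists (Num.truncn (e / 2)^-1); apply: filterS (near_nr x e2) => y yx k Nk z zy.
  have : k.+1%:R^-1 < e / 2.
    rewrite invf_plt ?posrE//; apply: lt_le_trans (truncnS_gt _) _.
    by rewrite ler_nat.
  move=> /(lt_trans zy) {}zy; apply: He; apply: le_lt_trans (nr_dist z y x) _.
  by rewrite [e]splitr ltrD.
by exists N.+1%:R^-1 => // x Kx y; exact: (HN N (leqnn _) x Kx y).
Qed.

(** The right-hand side dominates the integral of a function [glue Omega f G] of
    [PSHo X] that is at least [u - 3 e].  Here [f] is a sup-convolution of [u] minus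
    [3 e], and [G = g + A * psi], where [g] and [psi] in [PSHo X] approximate
    [v] and [phi].  On the boundary [u = v] and [phi = 0], hence [f < G] there
    and the gluing takes place on a compact subset of [Omega]. *)
Lemma psh_le_integral_max (f0 h : V -> R) (A : R) (z : V)
    (mu : probability (borel V) R) :
  {within X, continuous f0} -> {within X, continuous h} -> 0 <= A ->
  (forall x, X x -> (u x <= (f0 x)%:E)%E) -> (forall x, X x -> (v x <= (h x)%:E)%E) ->
  X z -> Jensen X z mu ->
  (u z <= \int[mu]_(x in X) (Num.max (f0 x) (h x + A * phi x))%:E)%E.
Proof.
move=> cf0 ch A0 uf0 vh Xz [_ muX Jmu]; apply: lee_eps => e' e'0.
pose e := e' / 3; have e0 : 0 < e by rewrite divr_gt0.
have X0 : X !=set0 by exists z.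
have mX : measurable (X : set (borel V)) by exact: closed_borel.
have [g [pg gP]] := PSH_approx cptX closedX pv ch vh e0.
have A1 : 0 < A + 1 by lra.
have d0 : 0 < e / (A + 1) by rewrite divr_gt0.
have [psi [ppsi psiP]] := PSH_approx cptX closedX pphi cphi (fun x _ => lexx _) d0.
pose G x := g x + A * psi x.
have pG : PSHo X G by apply: PSHoD => //; exact: PSHoZ.
have G_le x : X x -> G x <= h x + A * phi x.
  by move=> Xx; rewrite lerD ?ler_wpM2l ?(gP x Xx).1 ?(psiP x Xx).1.
have G_bd x : boundary Omega x -> (u x < (G x + 2 * e)%:E)%E.
  move=> bx; have Xx : X x by case: bx.
  rewrite uv//; apply: lt_le_trans (gP x Xx).2 _; rewrite lee_fin /G.
  have := (psiP x Xx).2; rewrite /= lte_fin phi0//.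
  move=> /ltW/(ler_wpM2l A0); rewrite mulr0 mulrDr.
  have : A * (e / (A + 1)) <= e by rewrite mulrCA -[leRHS]mulr1 ler_pM2l// ler_pdivrMr// mul1r; lra.
  by lra.
pose F := supconv X u.
have Fanti y : {homo F^~ y : k l / (k <= l)%N >-> l <= k} by exact: supconv_anti.
have cF k : continuous (F k) by exact: supconv_continuous.
(* The limit [u] of [F k] is at most [f0] on [X] and less than [G + 2 e] on the
   boundary; by compactness, [F k] exceeds these bounds by less than [e] for
   large [k]. *)
have [N1 HN1] : exists N, forall k, (N <= k)%N -> forall x, X x -> X x ->
    F k x < f0 x + e.
  apply: compact_eventually => // x Xx.
  have : (u x < (f0 x + e / 2)%:E)%E.
    by apply: le_lt_trans (uf0 x Xx) _; rewrite lte_fin ltrDl divr_gt0.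
  move=> /(supconv_lt cptX X0 uX Xx)[N HN]; exists N.
  have := within_cont_gt cf0 Xx (_ : f0 x - e / 2 < f0 x).
  rewrite ltrBlDr ltrDl divr_gt0// => /(_ isT).
  apply: filterS2 HN => y h1 h2 k Nk Xy; have := h1 k Nk; have := h2 Xy.
  by rewrite -/(F k y); lra.
have cptB : compact (boundary Omega).
  apply: (subclosed_compact _ cptX); last by move=> x [].
  apply: closedI => //; apply: open_closedC; exact: open_interior.
have cG := PSHo_cont pG.
have [N2 HN2] : exists N, forall k, (N <= k)%N -> forall x, boundary Omega x ->
    boundary Omega x -> F k x < G x + 3 * e.
  apply: compact_eventually => // x bx; have Xx : X x by case: bx.
  have := G_bd x bx; move=> /(supconv_lt cptX X0 uX Xx)[N HN]; exists N.
  have := within_cont_gt cG Xx (_ : G x - e < G x).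
  rewrite ltrBlDr ltrDl => /(_ e0).
  apply: filterS2 HN => y h1 h2 k Nk [Xy _]; have := h1 k Nk; have := h2 Xy.
  by rewrite -/(F k y); lra.
pose K := [set x | X x /\ 0 <= F N2 x - G x - 3 * e].
have clK : closed K.
  apply: within_cont_closed_ge => //; apply: within_contD; last exact: within_cont_cst.
  apply: within_contD; first by apply: continuous_subspaceT; exact: cF.
  by have := @within_contZ _ _ _ (-1) _ cG; under eq_fun do rewrite mulN1r.
have cptK : compact K by apply: (subclosed_compact clK cptX) => x [].
have KO : K `<=` Omega.
  move=> x [Xx]; have [//|bx] := closure_boundary Xx.
  by have := HN2 N2 (leqnn _) x bx bx; lra.
have [eta eta0 HK] := compact_margin cptK KO.
have eta2 : 0 < eta / 2 by rewrite divr_gt0.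
have [N3 HN3] := supconv_submean cptX X0 uX openO OX pu eta2.
pose k := maxn N1 (maxn N2 N3).
have kN1 : (N1 <= k)%N by rewrite leq_maxl.
have kN2 : (N2 <= k)%N by rewrite leq_max leq_maxl orbT.
have kN3 : (N3 <= k)%N by rewrite leq_max leq_maxr orbT.
pose f x := F k x - 3 * e.
have cf : continuous f by move=> x; apply: (continuousB (cF k x)); exact: cst_continuous.
have pW : PSHo X (glue Omega f G).
  apply: (PSHo_glue openO OX clK eta2) => //.
  - by move=> x Kx y yx; apply: (HK x Kx); lra.
  - move=> x Kx b bb.
    have ccF : circ_continuous (F k) x b.
      by move=> t; apply: continuous_comp; [exact: circle_continuous|exact: cF].
    rewrite /f (_ : mean _ x b = mean (F k) x b - 3 * e); last first.
      rewrite (meanD ccF); last by move=> t; exact: cvg_cst.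
      by rewrite mean_cst.
    rewrite lerD2r; apply: (HN3 k kN3) => w w1 y yw; apply: (HK x Kx).
    have : nr (w *: b) < eta / 2.
      by rewrite nrZ; apply: le_lt_trans bb; rewrite ler_piMl// nr_ge0.
    have := nr_dist y (x + w *: b) x; rewrite (_ : x + w *: b - x = w *: b).
      by move: yw; lra.
    by rewrite addrC addKr.
  - move=> x Ox nK; rewrite leNgt; apply/negP => fG; apply: nK; split; first exact: OX.
    by have := Fanti x N2 k kN2; move: fG; rewrite /f; lra.
apply: (@le_trans _ _ ((glue Omega f G z + 3 * e)%:E)%E).
  rewrite /glue; case: ifPn => [Oz|/negP nO].
    apply: le_trans (supconv_ge cptX uX k Xz) _; rewrite lee_fin -lerBlDr.
    by rewrite le_max lexx.
  have [Oz|bz] := closure_boundary Xz; first by case: nO; exact: mem_set.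
  by apply: ltW; apply: lt_le_trans (G_bd z bz) _; rewrite lee_fin; lra.
have -> : 3 * e = e' by rewrite /e mulrC divfK// pnatr_eq0.
rewrite EFinD leeD2r//; apply: le_trans (Jmu _ pW) _.
apply: le_integral_measurable => //.
- apply/measurable_EFinP; apply: within_cont_measurable => //; exact: PSHo_cont.
- apply/measurable_EFinP; apply: within_cont_measurable => //.
  apply: within_cont_max => //; apply: within_contD => //; exact: within_contZ.
move=> x Xx; rewrite lee_fin /glue; case: ifP => _.
  rewrite ge_max !le_max G_le// orbT andbT; apply/orP; left.
  by have := HN1 k kN1 x Xx Xx; rewrite /f; lra.
by rewrite le_max G_le ?orbT.
Qed.

End MainInequality.

(** * Passage to the limit *)

Section LimitPassage.
Local Open Scope ereal_scope.

(** Monotone convergence for the nonnegative functions [C - F k]. *)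
Lemma integral_decreasing_ge d (T : measurableType d) (R : realType)
    (mu : probability T R) (D : set T) (F : nat -> T -> R) (u : T -> \bar R)
    (C a : R) :
  measurable D -> mu D = 1 -> (forall k, mu.-integrable D (EFin \o F k)) ->
  measurable_fun D u -> (forall x, D x -> u x <= C%:E) ->
  (forall k x, D x -> (F k x <= C)%R) ->
  (forall x, D x -> {homo F^~ x : k l / (k <= l)%N >-> (l <= k)%R}) ->
  (forall x, D x -> forall b : R, u x < b%:E -> \forall k \near \oo, (F k x < b)%R) ->
  (forall k, a%:E <= \int[mu]_(x in D) (F k x)%:E) ->
  a%:E <= \int[mu]_(x in D) u x.
Proof.
move=> mD muD iF mu_ uC FC Fanti Fu aF.
pose g k x := (C - F k x)%:E.
have iC : mu.-integrable D (EFin \o (fun=> C)).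
  by apply: finite_measure_integrable_cst.
have ig k : mu.-integrable D (g k) by exact: (integrableB mD iC (iF k)).
have intC : \int[mu]_(x in D) C%:E = C%:E.
  by rewrite integral_cst// [X in _ * X](_ : _ = 1)// mule1.
have gnd x : D x -> nondecreasing_seq (g^~ x).
  by move=> Dx k l kl; rewrite lee_fin lerB// Fanti.
have gcvg x : D x -> cvgn (g^~ x).
  by move=> Dx; apply: ereal_nondecreasing_is_cvgn; exact: gnd.
pose G x := C%:E - u x.
have mG : measurable_fun D G by apply: emeasurable_funB.
have G0 x : D x -> 0 <= G x by move=> Dx; rewrite sube_ge0 ?uC// orbT.
have Glim x : D x -> G x <= limn (g^~ x).
  move=> Dx.
  have lim_ge (b : R) : u x < b%:E -> (C - b)%:E <= limn (g^~ x).
    move=> ub; apply: lime_ge; first exact: gcvg.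
    by apply: filterS (Fu x Dx b ub) => k h; rewrite lee_fin lerB// ltW.
  rewrite /G; have := uC x Dx; move: lim_ge; case: (u x) => [r| |]//= H _.
    apply: lee_eps => e e0; rewrite -leeBlDr// -!EFinB.
    by rewrite -addrA -opprD; apply: H; rewrite lte_fin ltrDl.
  rewrite leye_eq; apply/eqP/eqyP => A A0.
  have := H (C - A)%R (ltNyr _).
  by rewrite opprB addrC subrK.
have intG : \int[mu]_(x in D) G x <= (C - a)%:E.
  apply: (@le_trans _ _ (\int[mu]_(x in D) limn (g^~ x))).
    apply: ge0_le_integral => //.
    by apply: emeasurable_fun_cvg; [move=> k; exact: (measurable_int mu (ig k))|exact: gcvg].
  rewrite monotone_convergence//; first last.
  - by move=> k x Dx; rewrite lee_fin subr_ge0 FC.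
  - by move=> k; exact: (measurable_int mu (ig k)).
  apply: lime_le.
    apply: ereal_nondecreasing_is_cvgn => k l kl; apply: ge0_le_integral => //.
    - by move=> x Dx; rewrite lee_fin subr_ge0 FC.
    - exact: (measurable_int mu (ig k)).
    - exact: (measurable_int mu (ig l)).
    - by move=> x Dx; exact: gnd.
  apply: nearW => k; rewrite /g integralB_EFin// intC EFinB.
  by apply: leeB.
have iG : mu.-integrable D G.
  apply/integrableP; split => //.
  under eq_integral => x /set_mem Dx do rewrite gee0_abs ?G0//.
  by apply: le_lt_trans intG _; rewrite ltry.
have uE x : D x -> u x = C%:E - G x.
  move=> Dx; rewrite /G; have := uC x Dx; case: (u x) => [r| |]//= _.
  by rewrite -!EFinB opprB addrC subrK.
have -> : \int[mu]_(x in D) u x = C%:E - \int[mu]_(x in D) G x.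
  under eq_integral => x /set_mem Dx do rewrite uE//.
  by rewrite (integralB mD iC iG) intC.
have := integrable_fin_num mD iG; move: intG.
case: (\int[mu]_(x in D) G x) => [r| |]//= + _.
by rewrite -EFinB !lee_fin; lra.
Qed.

End LimitPassage.

Theorem theorem2 (R : realType) (n : nat) (Omega : set 'rV[R[i]]_n)
    (u : 'rV[R[i]]_n -> \bar R) :
  P_hyperconvex Omega ->
  psh Omega u ->
  usc_on (closure Omega) u ->
  (exists v : 'rV[R[i]]_n -> \bar R,
    PSH (closure Omega) v /\ forall z, boundary Omega z -> u z = v z) ->
  PSH (closure Omega) u.
Proof.
move=> [oO conO bO [phi [pphi cphi phi_nc phi0]]] pu uX [v [pv uv]].
have cptX := bounded_closure_compact bO.
have clX : closed (closure Omega) by exact: closed_closure.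
split => // z mu Xz Jmu.
have X0 : closure Omega !=set0 by exists z.
have mX : measurable (closure Omega : set (borel 'rV[R[i]]_n)) by exact: closed_borel.
have [vX _] := pv.
have phi_lt0 x : Omega x -> phi x < 0.
  exact: (PSH_boundary0_lt0 oO conO cptX pphi cphi phi_nc phi0).
have phi_le0 x : closure Omega x -> phi x <= 0.
  by move=> /closure_boundary[/phi_lt0/ltW//|/phi0 ->].
pose f k := supconv (closure Omega) u k.
pose h k := supconv (closure Omega) v k.
have cf k : {within closure Omega, continuous (f k)}.
  by apply: continuous_subspaceT; exact: supconv_continuous.
have ch k : {within closure Omega, continuous (h k)}.
  by apply: continuous_subspaceT; exact: supconv_continuous.
have fanti x : {homo f^~ x : k l / (k <= l)%N >-> l <= k} by exact: supconv_anti.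
have hanti x : {homo h^~ x : k l / (k <= l)%N >-> l <= k} by exact: supconv_anti.
pose F k x := Num.max (f k x) (h k x + k%:R * phi x).
have cF k : {within closure Omega, continuous (F k)}.
  apply: within_cont_max => //; apply: within_contD => //; exact: within_contZ.
have uF k : (u z <= \int[mu]_(x in closure Omega) (F k x)%:E)%E.
  apply: (psh_le_integral_max oO cptX pu uX pv uv pphi cphi phi0 (cf k) (ch k)) => //.
    by move=> x Xx; exact: supconv_ge.
  by move=> x Xx; exact: supconv_ge.
have Fanti x : closure Omega x -> {homo F^~ x : k l / (k <= l)%N >-> l <= k}.
  move=> Xx k l kl; rewrite /F ge_max !le_max fanti//=.
  by rewrite lerD ?orbT ?hanti// ler_wnM2r ?phi_le0// ler_nat.
have [B B0 FB] := within_cont_bounded cptX (cF 0%N).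
have FC k x : closure Omega x -> F k x <= B.
  move=> Xx; apply: le_trans (Fanti x Xx 0%N k (leq0n k)) _.
  exact: le_trans (ler_norm _) (FB x Xx).
(* Inside [Omega] the term [k * phi] sends the second entry of the maximum to
   [-oo]; on the boundary [phi] vanishes and both entries tend to [u = v]. *)
have Flim x : closure Omega x -> forall b : R, (u x < b%:E)%E ->
    \forall k \near \oo, F k x < b.
  move=> Xx b ub.
  have [N1 /nbhs_singleton HN1] := supconv_lt cptX X0 uX Xx ub.
  have [N2 HN2] : exists N, forall k, (N <= k)%N -> h k x + k%:R * phi x < b.
    have [Ox|bx] := closure_boundary Xx; last first.
      have vb : (v x < b%:E)%E by rewrite -uv.
      have [N /nbhs_singleton HN] := supconv_lt cptX X0 vX Xx vb.
      by exists N => k /HN; rewrite phi0// mulr0 addr0.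
    have px : 0 < - phi x by rewrite oppr_gt0 phi_lt0.
    exists (Num.truncn ((h 0%N x - b) / - phi x)).+1 => k Nk.
    have : (h 0%N x - b) / - phi x < k%:R.
      by apply: lt_le_trans (truncnS_gt _) _; rewrite ler_nat.
    by rewrite ltr_pdivrMr// mulrN; have := hanti x 0%N k (leq0n k); lra.
  exists (maxn N1 N2) => // k /=; rewrite geq_max => /andP[k1 k2].
  by rewrite /F gt_max HN1// HN2.
have [-> |uz] := eqVneq (u z) -oo%E; first exact: leNye.
have [uzoo _] := uX z Xz.
have [r ur] : exists r : R, u z = r%:E.
  by move: uz uzoo; case: (u z) => [r| |]//; exists r.
rewrite ur; apply: (@integral_decreasing_ge _ _ _ mu _ F u B) => //.
- by case: Jmu.
- by move=> k; exact: within_cont_integrable.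
- exact: usc_measurable.
- move=> x Xx; apply: le_trans (supconv_ge cptX uX 0%N Xx) _; rewrite lee_fin.
  by apply: le_trans (FC 0%N x Xx); rewrite le_max lexx.
- by move=> k; rewrite -ur.
Qed.
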